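(* Fix $\delta\in(0,1)$. There exist constants $C,c>0$ (possibly depending on $\delta$) such that the following holds. Let $0\leq\varepsilon_1\leq\varepsilon_2\leq1$ and consider testing, from $n$ samples from each distribution, $$H_0:\ d_{\mathrm{TV}}(P,Q)\leq\varepsilon_1\qquad\text{versus}\qquad H_1:\ d_{\mathrm{TV}}(P,Q)>\varepsilon_2 .$$ Let $f_0=g_{\varepsilon_1}$, $\mathcal S=\mathcal I_{\lceil n^{1/5}\rceil}$, and $$\psi_{n,\delta}=\mathbf 1\bigl\{\exists S\in\mathcal S:\ h_+(Q_n(S^{c}))<f_0(h_+(P_n(S)))\bigr\}.$$ If $$\varepsilon_2-\varepsilon_1\geq C\,n^{-2/5}\,(\log(2n))^{c},$$ then $$\sup_{(P,Q):\,d_{\mathrm{TV}}(P,Q)\leq\varepsilon_1}(P^n\times Q^n)(\psi_{n,\delta})\leq\delta\quad\text{and}\quad\sup_{(P,Q)\in\mathcal M_{\mathrm{LC}}:\,d_{\mathrm{TV}}(P,Q)>\varepsilon_2}(P^n\times Q^n)(1-\psi_{n,\delta})\leq\delta,$$ where the first supremum is over all pairs of distributions on $\mathbb R$.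
   Context: $d_{\mathrm{TV}}(P,Q)=\sup_A|P(A)-Q(A)|$. $g_\varepsilon(\alpha)=(1-\varepsilon-\alpha)_+$ (extended by $0$ for $\alpha>1$). A distribution on $\mathbb R$ is log-concave if it admits a density $p$ such that $\log p$ is concave on its support; $\mathcal M_{\mathrm{LC}}$ is the set of all pairs $(P,Q)$ of log-concave distributions on $\mathbb R$. Interval unions: $\mathcal I_K=\bigl\{\bigcup_{j=1}^K(a_j,b_j):\ -\infty\leq a_1\leq b_1\leq\cdots\leq a_K\leq b_K\leq\infty\bigr\}$, which has VC dimension $2K$. Data: $X_{1:n}\sim P^n$ and $Y_{1:n}\sim Q^n$ are independent samples with empirical distributions $P_n,Q_n$; $(P^n\times Q^n)(\psi)$ is the expectation of the test $\psi$ (value $1$ = rejection). $\tau_{n,\delta}=\frac{4\{\mathrm{VC}(\mathcal S)\log(2n)+\log(32/\delta)\}}{n}$ (here $\mathrm{VC}(\mathcal S)=2\lceil n^{1/5}\rceil$), with $n$ always assumed large enough that $\tau_{n,\delta}\leq\frac12$; $V(t)=\min\{t,(1-t)_+\}$ and $h_+(t)=\min\{t+\sqrt{\tau_{n,\delta}V(t)}+\tau_{n,\delta},1\}$ for $t\ge0$. *)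

(* Defs.v *)
From HB Require Import structures.
From mathcomp Require Import all_boot all_order all_algebra.
From mathcomp Require Import all_classical all_reals all_analysis.
From mathcomp Require Import zify lra.
Set Implicit Arguments.
Unset Strict Implicit.
Unset Printing Implicit Defensive.
Import Order.TTheory GRing.Theory Num.Theory.
Import numFieldNormedType.Exports.
Local Open Scope classical_set_scope.
Local Open Scope ring_scope.

Section iid_sample.
Context d (T : measurableType d) (R : realType).

Definition tuple_cons n (z : T * n.-tuple T) : n.+1.-tuple T :=
  [the n.+1.-tuple T of z.1 :: z.2].

Lemma measurable_tuple_cons n :
  measurable_fun [set: T * n.-tuple T] (@tuple_cons n).
Proof. by apply: measurable_cons; [exact: measurable_fst|exact: measurable_snd]. Qed.

HB.instance Definition _ n :=
  isMeasurableFun.Build _ _ _ _ (@tuple_cons n) (@measurable_tuple_cons n).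

Variable P : probability T R.

(* The n-fold product P^n, see [iid_law_box]. *)
Fixpoint iid_law (n : nat) : probability (n.-tuple T) R :=
  if n is m.+1 return probability (n.-tuple T) R
  then [the probability _ _ of distribution (P \x iid_law m)%E (@tuple_cons m)]
  else [the probability _ _ of dirac ([tuple] : 0.-tuple T)].

Lemma iid_law_box n (A : 'I_n -> set T) : (forall i, measurable (A i)) ->
  iid_law n [set t | forall i, A i (tnth t i)] = (\prod_(i < n) P (A i))%E.
Proof.
elim: n A => [|n IHn] A mA.
  rewrite big_ord0 /= diracE mem_set//=.
  by case.
rewrite big_ord_recl -IHn//= /distribution /pushforward /=.
have mB : measurable [set t : n.-tuple T | forall i, A (lift ord0 i) (tnth t i)].
  rewrite [X in measurable X](_ : _ = \bigcap_(i in [set: 'I_n])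
      ((fun t : n.-tuple T => tnth t i) @^-1` A (lift ord0 i))); last first.
    by apply/seteqP; split=> [t H i _|t H i]; exact: H.
  apply: fin_bigcap_measurable => // i _.
  by rewrite -[X in measurable X]setTI; apply: measurable_tnth.
rewrite -product_measure1E//; congr ((P \x iid_law n)%E _).
apply/seteqP; split=> [[x t] /= H|[x t] /= [Hx Ht] i].
  split=> [|i]; first by have := H ord0; rewrite tnth0.
  by have := H (lift ord0 i); rewrite tnthS.
by case: (unliftP ord0 i) => [j ->|->]; [rewrite tnthS; exact: Ht|rewrite tnth0].
Qed.

End iid_sample.

Section notions.
Context (R : realType).
Local Notation RR := (measurableTypeR R).

Definition tv_dist (P Q : probability RR R) : \bar R :=
  ereal_sup [set `|P A - Q A|%E | A in [set A : set RR | measurable A]].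

(* {p > 0} is required to be convex: it is the domain of the concave function
   log p. *)
Definition log_concave (p : R -> R) : Prop :=
  let supp : set R^o := [set x | 0 < p x] in
  convex_set supp /\ convex_function supp (fun x => - ln (p x)).

Definition log_concave_distribution (P : probability RR R) : Prop :=
  exists p : RR -> R,
    [/\ measurable_fun setT p, (forall x, 0 <= p x), log_concave p &
      forall A, measurable A ->
        P A = (\int[lebesgue_measure]_(x in A) (p x)%:E)%E].

Definition interval_unions (K : nat) : set (set R) :=
  [set S | exists a b : 'I_K -> \bar R,
    [/\ (forall j, (a j <= b j)%E),
        (forall i j : 'I_K, j = i.+1 :> nat -> (b i <= a j)%E) &
        S = \bigcup_j [set x : R | (a j < x%:E < b j)%E]]].

Definition shatters (T : Type) (Ss : set (set T)) (F : set T) : Prop :=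
  forall B, B `<=` F -> exists2 S, Ss S & S `&` F = B.

(* The value is +oo when arbitrarily large finite sets are shattered, while
   [tau] reads it through [fine]; for [interval_unions] it is finite, see
   [vc_dim_interval_unions]. *)
Definition vc_dim (T : Type) (Ss : set (set T)) : \bar R :=
  ereal_sup [set (m%:R : R)%:E | m in
    [set m | exists2 F : set T, (F #= `I_m)%card & shatters Ss F]].

Definition empirical n (x : n.-tuple RR) (S : set R) : R :=
  (\sum_(i < n) \1_S (tnth x i)) / n%:R.

(* The maximum with 0 also gives the extension by 0 to alpha > 1. *)
Definition g_tv (eps alpha : R) : R := Num.max (1 - eps - alpha) 0.

Definition tau (Ss : set (set R)) (n : nat) (delta : R) : R :=
  4 * (fine (vc_dim Ss) * ln (2 * n%:R) + ln (32 / delta)) / n%:R.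

Definition V (t : R) : R := Num.min t (Num.max (1 - t) 0).

Definition h_plus (tau : R) (t : R) : R :=
  Num.min (t + Num.sqrt (tau * V t) + tau) 1.

Definition psi (Ss : set (set R)) (f0 : R -> R) (n : nat) (delta : R)
    (xy : n.-tuple RR * n.-tuple RR) : R :=
  let h := h_plus (tau Ss n delta) in
  \1_[set z : n.-tuple RR * n.-tuple RR | exists2 S, Ss S &
       h (empirical z.2 (~` S)) < f0 (h (empirical z.1 S))] xy.

Definition ceil_root5 (n : nat) : nat := `|Num.ceil ((n%:R : R) `^ (1 / 5))|%N.

End notions.

Arguments psi {R} Ss f0 n delta xy.

Section vc.
Context (R : realType).

Lemma interval_unions_shatters (K : nat) :
  exists2 F : set R, (F #= `I_(2 * K))%card & shatters (@interval_unions R K) F.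
Proof.
have inj_f : injective (fun i : nat => i%:R : R).
  by move=> i j /eqP; rewrite eqr_nat => /eqP.
exists [set (i%:R : R) | i in `I_(2 * K)].
  by apply: inj_card_eq; move=> i j _ _; exact: inj_f.
move=> B BF.
pose a (j : 'I_K) : R :=
  if `[< B (2 * j)%:R >] then (2 * j)%:R - 1 / 2 else (2 * j)%:R + 1 / 2.
pose b (j : 'I_K) : R :=
  if `[< B (2 * j).+1%:R >] then (2 * j)%:R + 3 / 2 else (2 * j)%:R + 1 / 2.
exists (\bigcup_j [set x : R | ((a j)%:E < x%:E < (b j)%:E)%E]).
  exists (fun j => (a j)%:E), (fun j => (b j)%:E); split=> //.
    by move=> j; rewrite lee_fin /a /b; case: ifP; case: ifP => _ _; lra.
  move=> i j jE; rewrite lee_fin /a /b jE mulnS natrD.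
  by case: ifP; case: ifP => _ _; lra.
apply/seteqP; split=> x.
  case=> -[j _ /=]; rewrite !lte_fin => /andP[ax xb] [k /= kK xE].
  have [kj|[kj|kj]] : ((k < 2 * j) \/ ((2 * j).+1 < k) \/ (k = 2 * j \/ k = (2 * j).+1))%N
    by lia.
  - have : k.+1%:R <= (2 * j)%:R :> R by rewrite ler_nat.
    by rewrite -natr1; move: ax; rewrite /a -xE; case: ifP => _; lra.
  - have : (2 * j).+2%:R <= k%:R :> R by rewrite ler_nat.
    rewrite -addn2 natrD; move: xb; rewrite /b -xE; case: ifP => _; lra.
  - case: kj => kj; subst k.
      move: ax; rewrite /a -xE; case: ifP => [/asboolP //|_]; lra.
    by move: xb; rewrite /b -xE; case: ifP => [/asboolP //|_]; rewrite -natr1; lra.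
move=> Bx; split; last exact: BF.
have [k /= kK xE] := BF _ Bx.
have jK : (k./2 < K)%N by lia.
exists (Ordinal jK) => //=; rewrite !lte_fin /a /b /=.
have kk := odd_double_half k; rewrite -mul2n in kk.
have [kE|kE] : (k = (2 * k./2).+1 \/ k = 2 * k./2)%N by case: (odd k) kk => /=; lia.
  have xE' : x = (2 * k./2)%:R + 1 by rewrite -xE {1}kE -natr1.
  rewrite -kE xE; have -> : `[< B x >] by exact/asboolP.
  by rewrite xE'; case: ifP => _; apply/andP; split; lra.
rewrite -kE xE; have -> : `[< B x >] by exact/asboolP.
by case: ifP => _; apply/andP; split; lra.
Qed.

Lemma interval_unions_not_shatters (K m : nat) (F : set R) :
  (F #= `I_m)%card -> shatters (@interval_unions R K) F -> (m <= 2 * K)%N.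
Proof.
move=> Fm sF; rewrite leqNgt; apply/negP => mK.
have finF : finite_set F by exists m.
pose s := sort <=%R (finmap.enum_fset (fset_set F)).
have sz : size s = m.
  by rewrite size_sort; exact: card_fset_set.
have mem x : (x \in s) = (x \in F).
  by rewrite mem_sort in_fset_set.
have lts : sorted <%R s.
  by rewrite lt_sorted_uniq_le sort_uniq finmap.fset_uniq sort_le_sorted.
have ltx i j : (i < j)%N -> (j < m)%N -> s`_i < s`_j.
  move=> ij jm; apply: (sorted_ltn_nth lt_trans) => //; rewrite inE sz //.
  exact: ltn_trans ij jm.
have sub : [set s`_(2 * i) | i in `I_K.+1] `<=` F.
  move=> _ [i /= iK <-]; apply/set_mem; rewrite -mem; apply: mem_nth; rewrite sz; lia.
have [S [a [b [_ _ ->]]] SB] := sF _ sub.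
have H (i : 'I_K.+1) : exists j : 'I_K, (a j < (s`_(2 * i))%:E < b j)%E.
  have : [set s`_(2 * i) | i in `I_K.+1] s`_(2 * i) by exists (i : nat) => //=.
  by rewrite -SB => -[[j _ Hj] _]; exists j; exact: Hj.
pose f i := projT1 (cid (H i)).
have fP i : (a (f i) < (s`_(2 * i))%:E < b (f i))%E by exact: projT2 (cid (H i)).
have lt_f (i j : 'I_K.+1) : (i < j)%N -> f i <> f j.
  move=> ij fij.
  have jK := ltn_ord j.
  have : [set s`_(2 * i) | i in `I_K.+1] s`_(2 * i).+1.
    rewrite -SB; split; last by apply/set_mem; rewrite -mem; apply: mem_nth; rewrite sz; lia.
    exists (f i) => //=; apply/andP; split.
      have /andP[ai _] := fP i; apply: (lt_trans ai); rewrite lte_fin; apply: ltx; lia.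
    have /andP[_ bj] := fP j; rewrite fij; apply: lt_trans bj.
    by rewrite lte_fin; apply: ltx; lia.
  case=> k /= kK /eqP; rewrite nth_uniq ?sz; try lia.
  by rewrite sort_uniq finmap.fset_uniq.
have injf : injective f.
  move=> i j fij; apply/val_inj; case: (ltngtP i j) => // ij.
    by have := lt_f _ _ ij.
  by have := lt_f _ _ ij; rewrite fij.
by have := leq_card f injf; rewrite !card_ord ltnn.
Qed.

Lemma vc_dim_interval_unions (K : nat) :
  vc_dim R (@interval_unions R K) = (2 * K)%:R%:E.
Proof.
apply/eqP; rewrite eq_le; apply/andP; split.
  apply: ge_ereal_sup => _ [m [F Fm sF] <-].
  by rewrite lee_fin ler_nat; exact: interval_unions_not_shatters Fm sF.
apply: ereal_sup_ubound; exists (2 * K)%N => //.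
exact: interval_unions_shatters.
Qed.
End vc.

(* Main.v *)
From HB Require Import structures.
Require Import Defs.
From mathcomp Require Import all_boot all_order all_algebra.
From mathcomp Require Import all_classical all_reals all_analysis.
From mathcomp Require Import measurable_realfun.
From mathcomp Require Import ring lra zify.
Import Order.TTheory GRing.Theory Num.Theory.
Import numFieldNormedType.Exports.
Set Implicit Arguments.
Unset Strict Implicit.
Unset Printing Implicit Defensive.
Local Open Scope classical_set_scope.
Local Open Scope ring_scope.

(** Write h for h_+, P_n and Q_n for the empirical measures, ~S for the
    complement of S, and K for the number of intervals.

    Level. Suppose that P(S) <= h(P_n(S)) and Q(~S) <= h(Q_n(~S)) for every S of
    the class. Then a rejection gives an S with Q(~S) < 1 - eps1 - P(S), that is,
    P(~S) - Q(~S) > eps1, which the null hypothesis excludes. It remains to see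
    that these inequalities hold simultaneously with probability 1 - delta. For a
    single set of mass p and frequency q, Chernoff's bound gives p - q <= sqrt (t p)
    and, for the complement, p - q <= sqrt (t (1 - q)), each up to probability
    exp (- n t / 2) ([lower_tail], [upper_tail]); solving for p gives p <= h q
    ([le_h_plus]). Uniformity over S comes from bracketing: with the line cut at
    the k/n-quantiles of P, every S lies between two sets taken from a family of
    n^(2 K) pairs whose masses differ by at most 2 K / n
    ([interval_unions_bracketing]). With t = 3 tau / 4 the Chernoff bound is
    at most (2 n)^(- 3 K) delta / 32, which pays for the union bound over the
    brackets ([union_bound_le]), and the remaining tau / 4 absorbs the bracketing
    error ([bracketing_error_le]).

    Power. One good S is enough: its empirical masses fluctuate by at most
    sqrt tau, which is of order n^(-2/5) up to logarithms, so the test rejects as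
    soon as Q(S) - P(S) exceeds eps1 by a multiple of sqrt tau
    ([type_two_error]). Such an S is obtained from approximations g and h of the
    two densities: if both are exponentials of piecewise affine functions with
    fewer than K breakpoints altogether, then {g < h} is a union of K intervals
    apart from the breakpoints ([sign_set_interval_union]), and using it instead
    of the best set costs at most the two L1 errors ([sign_set_near_optimal]).

    It remains to approximate a log-concave density p with about K pieces and an
    L1 error of order K^(-2) up to logarithms ([log_concave_approx]). The line is
    cut at the quantiles 2^(-j) and 1 - 2^(-j) for j <= J. Consider a block of
    mass at most a with mass at least a on either side. A secant of ln p
    extends to an upper bound of ln p outside its endpoints, so a steep secant
    would make one of the sides carry little mass; hence the slopes are at most
    of order p / a ([secant_left_tail], [secant_right_tail]), and ln p varies by at
    most 1 on the block ([log_density_oscillation]). On each of m equal pieces of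
    the block ln p is replaced by its chord. The error of a chord is controlled
    by the difference of two consecutive secant slopes, and these differences
    telescope, so that the block contributes an error of order a / m^2
    ([log_affine_approx_block]). Taking J of order ln n and m of order K / J
    balances everything, the two tails of mass 2^(-J) being neglected. *)

(** * Probabilities as real numbers *)

Section pr.
Context d (T : measurableType d) (R : realType).
Implicit Types (P : probability T R) (A B : set T).

Definition pr P A : R := fine (P A).

Lemma prE P A : measurable A -> P A = (pr P A)%:E.
Proof. by move=> mA; rewrite /pr fineK// fin_num_measure. Qed.

Lemma pr_ge0 P A : 0 <= pr P A.
Proof. by rewrite /pr fine_ge0. Qed.

Lemma pr_le1 P A : measurable A -> pr P A <= 1.
Proof. by move=> mA; rewrite -lee_fin -prE// probability_le1. Qed.

Lemma le_pr P A B : measurable A -> measurable B -> A `<=` B ->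
  pr P A <= pr P B.
Proof. by move=> mA mB AB; rewrite -lee_fin -!prE// le_measure ?inE. Qed.

Lemma pr_setC P A : measurable A -> pr P (~` A) = 1 - pr P A.
Proof.
move=> mA; apply: EFin_inj.
by rewrite -prE ?probability_setC ?prE//; exact: measurableC.
Qed.

Lemma pr_setU_le P A B : measurable A -> measurable B ->
  pr P (A `|` B) <= pr P A + pr P B.
Proof.
move=> mA mB; rewrite -lee_fin EFinD -!prE//; last exact: measurableU.
exact: measureU2.
Qed.

Lemma pr_setU P A B : measurable A -> measurable B -> [disjoint A & B] ->
  pr P (A `|` B) = pr P A + pr P B.
Proof.
move=> mA mB /disj_set2P AB; apply: EFin_inj; rewrite EFinD -!prE//; last exact: measurableU.
by rewrite measureU.
Qed.

Lemma measurable_finite_union (I : finType) (F : I -> set T) :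
  (forall i, measurable (F i)) -> measurable (\bigcup_i F i).
Proof. by move=> mF; apply: fin_bigcup_measurable. Qed.

Lemma pr_bigcup_le P (I : finType) (F : I -> set T) :
  (forall i, measurable (F i)) ->
  pr P (\bigcup_i F i) <= \sum_i pr P (F i).
Proof.
move=> mF; have -> : \bigcup_i F i = \big[setU/set0]_i F i.
  by rewrite -bigcup_pred; congr (\bigcup_(_ in _) _); apply/seteqP; split.
elim: (index_enum I) => [|i s IH]; first by rewrite !big_nil /pr measure0.
rewrite !big_cons; apply: le_trans (lerD (lexx _) IH).
by apply: pr_setU_le => //; exact: bigsetU_measurable.
Qed.

End pr.

Lemma product_prE d1 d2 (T1 : measurableType d1) (T2 : measurableType d2)
    (R : realType) (P : probability T1 R) (Q : probability T2 R) A B :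
  measurable A -> measurable B ->
  (P \x Q)%E (A `*` B) = (pr P A * pr Q B)%:E.
Proof.
move=> mA mB; rewrite product_measure1E// EFinM.
by rewrite -[(pr P A)%:E]prE// -[(pr Q B)%:E]prE.
Qed.

(** * Chernoff bounds for the frequency of a set *)

Section chernoff.
Context d (T : measurableType d) (R : realType).
Variable P : probability T R.

Definition hits n (A : set T) (x : n.-tuple T) : R :=
  \sum_(i < n) \1_A (tnth x i).

Arguments hits {n}.

Lemma measurable_hits n A : measurable A ->
  measurable_fun [set: n.-tuple T] (hits A).
Proof.
move=> mA; apply: measurable_sum => i.
by apply: (measurableT_comp (measurable_indic mA)); exact: measurable_tnth.
Qed.

Lemma measurable_hits_ge n (A : set T) (l c : R) : measurable A ->
  measurable [set x : n.-tuple T | c <= l * hits A x].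
Proof.
move=> mA; rewrite -[X in measurable X]setTI.
have -> : [set x : n.-tuple T | c <= l * hits A x] =
  (fun x : n.-tuple T => l * hits A x) @^-1` `[c, +oo[%classic by apply/seteqP; split=> x /=; rewrite in_itv/= andbT.
by apply: measurable_funM => //; exact: measurable_hits.
Qed.

Lemma hits_cons n A (z : T * n.-tuple T) :
  hits A (tuple_cons z) = \1_A z.1 + hits A z.2.
Proof.
rewrite /hits big_ord_recl tnth0; congr (_ + _).
by apply: eq_bigr => i _; rewrite tnthS.
Qed.

(** Splitting off the first observation turns the event into a disjoint union of
    two rectangles, so the exponential moment factorizes by induction on [n]
    with no integral involved. The factor [l] may have either sign, which covers
    both tails. *)
Lemma chernoff n (A : set T) (l c : R) : measurable A ->
  (iid_law P n [set x | (c <= l * hits A x)%R] <=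
   (expR (- c) * (1 - pr P A + pr P A * expR l) ^+ n)%:E)%E.
Proof.
move=> mA; elim: n c => [|n IHn] c.
  rewrite expr0 mulr1 /= diracE; case: (boolP (_ \in _)) => [|_].
    by rewrite inE /= /hits big_ord0 mulr0 => c0; rewrite lee_fin -expR0 ler_expR oppr_ge0.
  by rewrite lee_fin expR_ge0.
have m1 : measurable (A `*` [set x : n.-tuple T | c - l <= l * hits A x]).
  by apply: measurableX => //; exact: measurable_hits_ge.
have m2 : measurable ((~` A) `*` [set x : n.-tuple T | c <= l * hits A x]).
  by apply: measurableX; [exact: measurableC|exact: measurable_hits_ge].
rewrite /= /distribution /pushforward /=.
rewrite (_ : _ @^-1` _ = (A `*` [set x : n.-tuple T | c - l <= l * hits A x])
   `|` ((~` A) `*` [set x : n.-tuple T | c <= l * hits A x])); last first.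
  apply/seteqP; split=> -[x t] /=; rewrite hits_cons mulrDr.
    have [xA|xA] := pselect (A x); rewrite indicE/=.
      by rewrite mem_set//= mulr1 => H; left; split=> //; rewrite lerBlDl.
    by rewrite memNset//= mulr0 add0r; right.
  case=> -[xA]; rewrite indicE /=; first by rewrite mem_set//= mulr1 lerBlDl.
  by rewrite memNset//= mulr0 add0r.
have leU : ((P \x iid_law P n)
    ((A `*` [set x : n.-tuple T | (c - l <= l * hits A x)%R]) `|`
     ((~` A) `*` [set x : n.-tuple T | (c <= l * hits A x)%R])) <=
   (P \x iid_law P n) (A `*` [set x : n.-tuple T | (c - l <= l * hits A x)%R]) +
   (P \x iid_law P n) ((~` A) `*` [set x : n.-tuple T | (c <= l * hits A x)%R]))%E.
  exact: measureU2.
apply: (le_trans leU).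
rewrite !product_prE//; try exact: measurable_hits_ge; last exact: measurableC.
rewrite pr_setC// -EFinD.
have H k : pr (iid_law P n) [set x | k <= l * hits A x] <=
  expR (- k) * (1 - pr P A + pr P A * expR l) ^+ n.
  by rewrite -lee_fin -prE//; exact: measurable_hits_ge.
rewrite lee_fin.
apply: (le_trans (lerD (ler_wpM2l (pr_ge0 _ _) (H _)) (ler_wpM2l _ (H _)))).
  by rewrite subr_ge0 pr_le1.
rewrite opprB expRD exprS.
by rewrite le_eqVlt; apply/orP; left; apply/eqP; ring.
Qed.

End chernoff.

Arguments hits {d T R n} A x.

Section exp_bounds.
Context (R : realType).
Implicit Types s u : R.

Lemma expRN_le_quad s : 0 <= s -> expR (- s) <= 1 - s + s ^+ 2 / 2.
Proof.
move=> s0; pose f x : R := 1 - x + x ^+ 2 / 2 - expR (- x).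
have df (x : R) : is_derive x 1 f (- 1 + x + expR (- x)).
  by rewrite /f; apply: is_derive_eq; rewrite /GRing.scale /=; field.
have : f 0 <= f s.
  apply: (@ger0_derive1_ndecr R f 0 s) => //.
  - by move=> x _; rewrite derive1E derive_val addrAC; have := expR_ge1Dx (- x); lra.
  - by apply: continuous_subspaceT => x; exact/differentiable_continuous/derivable1_diffP.
by rewrite /f oppr0 expR0; lra.
Qed.

(** The constant 1/2 in front of [u ^+ 2] is the sharp one; it is what gives the
    upper tail the same exponent as the lower one. *)
Lemma onem_le_expR_quad u : 0 <= u < 1 -> 1 - u <= expR (- (u + u ^+ 2 / 2)).
Proof.
move=> /andP[u0 u1]; pose f x : R := (1 - x) * expR (x + x ^+ 2 / 2).
have df (x : R) : is_derive x 1 f (- x ^+ 2 * expR (x + x ^+ 2 / 2)).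
  by rewrite /f; apply: is_derive_eq; rewrite /GRing.scale /=; field.
have : f u <= f 0.
  apply: (@ler0_derive1_nincr R f 0 u) => //.
  - by move=> x _; rewrite derive1E derive_val mulr_le0_ge0 ?expR_ge0// oppr_le0 sqr_ge0.
  - by apply: continuous_subspaceT => x; exact/differentiable_continuous/derivable1_diffP.
rewrite /f subr0 expr0n /= mul0r addr0 expR0 mulr1 => H.
by rewrite expRN -[leRHS]mul1r ler_pdivlMr ?expR_gt0.
Qed.

End exp_bounds.

Section tails.
Context d (T : measurableType d) (R : realType).
Variable P : probability T R.

(** The empirical measure of [A], for samples in an arbitrary measurable space. *)
Definition freq n (A : set T) (x : n.-tuple T) : R := hits A x / n%:R.

Arguments freq {n}.

Lemma freq_ge0 n A (x : n.-tuple T) : 0 <= freq A x.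
Proof. by rewrite /freq divr_ge0// sumr_ge0// => i _; rewrite indicE. Qed.

Lemma freq_le1 n A (x : n.-tuple T) : freq A x <= 1.
Proof.
rewrite /freq; have [n0|n0] := posnP n.
  by rewrite [X in _ / X%:R]n0 invr0 mulr0 ler01.
have nE : (n%:R : R) = \sum_(i < n) 1 by rewrite sumr_const card_ord.
rewrite ler_pdivrMr ?ltr0n// mul1r [leRHS]nE.
by apply: ler_sum => i _; rewrite indicE; case: (_ \in _).
Qed.

Lemma le_freq n (A B : set T) (x : n.-tuple T) : A `<=` B ->
  freq A x <= freq B x.
Proof.
move=> AB; rewrite /freq ler_wpM2r// ler_sum// => i _; rewrite !indicE.
by case: (boolP (_ \in A)) => [|//]; rewrite inE => /AB /mem_set ->.
Qed.

Lemma freq_setC n (A : set T) (x : n.-tuple T) : (0 < n)%N ->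
  freq (~` A) x = 1 - freq A x.
Proof.
move=> n0; have n0' : (n%:R : R) != 0 by rewrite pnatr_eq0 -lt0n.
have nE : (n%:R : R) = \sum_(i < n) 1 by rewrite sumr_const card_ord.
apply: (mulIf n0'); rewrite /freq mulrBl !divfK// mul1r [X in X - _]nE.
rewrite /hits -sumrB; apply: eq_bigr => i _.
by rewrite !indicE in_setC; case: (_ \in _); rewrite /= ?subr0 ?subrr.
Qed.

Lemma measurable_freq n A : measurable A ->
  measurable_fun [set: n.-tuple T] (freq A).
Proof. by move=> mA; apply: measurable_funM => //; exact: measurable_hits. Qed.

Definition lower_dev n (t : R) (A : set T) : set (n.-tuple T) :=
  [set x | Num.sqrt (t * pr P A) < pr P A - freq A x].

Definition upper_dev n (t : R) (A : set T) : set (n.-tuple T) :=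
  [set x | Num.sqrt (t * freq A x) < freq A x - pr P A].

Lemma measurable_lower_dev n t A : measurable A -> measurable (@lower_dev n t A).
Proof.
move=> mA; rewrite -[X in measurable X]setTI.
by apply: measurable_fun_ltr => //; apply: measurable_funB => //; exact: measurable_freq.
Qed.

Lemma measurable_upper_dev n t A : measurable A -> measurable (@upper_dev n t A).
Proof.
move=> mA; rewrite -[X in measurable X]setTI.
have mf := @measurable_freq n A mA.
apply: measurable_fun_ltr => //; last exact: measurable_funB.
apply: (measurableT_comp (continuous_measurable_fun (@sqrt_continuous R))).
exact: measurable_funM.
Qed.

(** Exponential form of [chernoff], from 1 - p + p e^l <= exp (p (e^l - 1)); the
    threshold [m] is a frequency and [b] bounds the exponent per observation. *)
Lemma chernoff_expR n (A : set T) (l m b : R) : measurable A ->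
  pr P A * (expR l - 1) - l * m <= b ->
  pr (iid_law P n) [set x | (l * (n%:R * m) <= l * hits A x)%R] <= expR (n%:R * b).
Proof.
move=> mA H; rewrite -lee_fin -prE; last exact: measurable_hits_ge.
have := chernoff P n l (l * (n%:R * m)) mA => /le_trans; apply; rewrite lee_fin.
have -> : 1 - pr P A + pr P A * expR l = 1 + pr P A * (expR l - 1) by ring.
apply: (@le_trans _ _ (expR (- (l * (n%:R * m))) * expR (pr P A * (expR l - 1)) ^+ n)).
  rewrite ler_wpM2l ?expR_ge0// lerXn2r ?nnegrE ?expR_ge0 ?expR_ge1Dx//.
  have := expR_ge0 l; have := pr_ge0 P A; have := pr_le1 P mA; nra.
rewrite -expRM_natl -expRD ler_expR.
have -> : - (l * (n%:R * m)) + n%:R * (pr P A * (expR l - 1)) =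
  n%:R * (pr P A * (expR l - 1) - l * m) by ring.
by rewrite ler_wpM2l.
Qed.

(** Chernoff's bound with the parameter - s for s = sqrt (t / p), the minimizer of
    the exponent once e^(- s) is replaced by 1 - s + s^2 / 2. *)
Lemma lower_tail n (t : R) A : (0 < n)%N -> 0 < t -> measurable A ->
  pr (iid_law P n) (@lower_dev n t A) <= expR (n%:R * (- (t / 2))).
Proof.
move=> n0 t0 mA; set p := pr P A.
have n0' : 0 < (n%:R : R) by rewrite ltr0n.
have [p0|p0] := eqVneq p 0.
  rewrite (_ : lower_dev _ _ = set0) ?/pr ?measure0 ?expR_ge0//.
  apply/seteqP; split => // x; rewrite /lower_dev /= -/p p0 mulr0 sqrtr0 sub0r.
  by rewrite oppr_gt0 ltNge freq_ge0.
have pgt0 : 0 < p by rewrite lt_neqAle eq_sym p0 pr_ge0.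
set s := Num.sqrt (t / p); set m := p - Num.sqrt (t * p).
have s0 : 0 < s by rewrite sqrtr_gt0 divr_gt0.
have s2 : s ^+ 2 = t / p by rewrite sqr_sqrtr// divr_ge0// ltW.
have sp : Num.sqrt (t * p) = s * p.
  have -> : t * p = t / p * p ^+ 2 by field.
  by rewrite sqrtrM ?sqrtr_sqr ?ger0_norm ?pr_ge0// divr_ge0// ltW.
have C := @chernoff_expR n A (- s) m (- (t / 2)) mA.
apply: le_trans (C _); last first.
  have := expRN_le_quad (ltW s0); rewrite -/p => H.
  have {}H : p * (expR (- s) - 1) <= p * (- s + s ^+ 2 / 2).
    by rewrite ler_pM2l//; lra.
  apply: (le_trans (lerB H (lexx _))); rewrite /m sp s2.
  have -> : p * (- s + t / p / 2) - - s * (p - s * p) = t / 2 - s ^+ 2 * p by field.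
  by rewrite s2 divfK//; lra.
apply: le_pr; [exact: measurable_lower_dev|exact: measurable_hits_ge|].
move=> x; rewrite /lower_dev /freq /= -/p => H.
rewrite !mulNr lerN2 ler_pM2l// mulrC -ler_pdivrMr// /m; lra.
Qed.

(** The event says that the frequency exceeds y^2, the positive solution of
    y^2 - p = sqrt t * y. The optimal parameter is ln (y^2 / p); with
    u = 1 - p / y^2, the smaller u + u^2 / 2 suffices and makes sense for p = 0 too. *)
Lemma upper_tail n (t : R) A : (0 < n)%N -> 0 < t -> measurable A ->
  pr (iid_law P n) (@upper_dev n t A) <= expR (n%:R * (- (t / 2))).
Proof.
move=> n0 t0 mA; set p := pr P A.
have n0' : 0 < (n%:R : R) by rewrite ltr0n.
set c := Num.sqrt t; have c0 : 0 < c by rewrite sqrtr_gt0.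
have c2 : c ^+ 2 = t by rewrite sqr_sqrtr// ltW.
have p0 : 0 <= p by exact: pr_ge0.
(* y is the square root of the smallest frequency in the event *)
set y := (c + Num.sqrt (t + 4 * p)) / 2.
have y2 : y ^+ 2 = c * y + p.
  have : Num.sqrt (t + 4 * p) ^+ 2 = t + 4 * p by rewrite sqr_sqrtr//; lra.
  by rewrite /y -c2; set w := Num.sqrt _ => w2; nra.
have y0 : 0 < y by rewrite /y; have := sqrtr_ge0 (t + 4 * p); lra.
have cy : c <= y.
  suff : c <= Num.sqrt (t + 4 * p) by rewrite /y; lra.
  by rewrite /c ler_sqrt; lra.
set u := c / y; have u01 : 0 <= u <= 1.
  apply/andP; split; first by apply: divr_ge0; exact: ltW.
  by rewrite /u ler_pdivrMr ?mul1r.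
set l := u + u ^+ 2 / 2.
have l0 : 0 < l.
  have u0 : 0 < u by rewrite divr_gt0.
  by rewrite addr_gt0// divr_gt0// exprn_gt0.
have uy : u * y = c by rewrite /u divfK// gt_eqF.
have C := @chernoff_expR n A l (y ^+ 2) (- (t / 2)) mA.
apply: le_trans (C _); last first.
  rewrite -/p; have pE : p = y ^+ 2 * (1 - u).
    have E : y ^+ 2 = u * y * y + p by rewrite uy.
    by rewrite mulrBr mulr1 {1}E expr2; ring.
  have H : p * expR l <= y ^+ 2.
    rewrite pE -mulrA ler_piMr ?sqr_ge0//.
    have [->|u1] := eqVneq u 1; first by rewrite subrr mul0r ler01.
    have : 1 - u <= expR (- l).
      by apply: onem_le_expR_quad; case/andP: u01 => -> /=; rewrite lt_neqAle u1.
    by rewrite expRN -[X in _ <= X]mul1r ler_pdivlMr ?expR_gt0.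
  have : u ^+ 2 * y ^+ 2 = t by rewrite -exprMn uy.
  by rewrite mulrBr mulr1 /l pE in H *; nra.
apply: le_pr; [exact: measurable_upper_dev|exact: measurable_hits_ge|].
move=> x; rewrite /upper_dev /= -/p => H.
rewrite ler_pM2l// mulrC -ler_pdivlMr// -/(freq A x).
have q0 := freq_ge0 A x; move: H; set q := freq A x in q0 *.
rewrite sqrtrM ?(ltW t0)// -/c.
have : Num.sqrt q ^+ 2 = q by rewrite sqr_sqrtr.
have := sqrtr_ge0 q; set z := Num.sqrt q => z0 <- H.
rewrite leNgt; apply/negP => zy; have {}zy : z < y by nra.
by have : z * (y - z) >= 0; [nra|nra].
Qed.

End tails.

Arguments freq {d T R n} A x.

(** * Quantiles and bracketing of interval unions *)

Section limits.
Context d (T : measurableType d) (R : realType).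
Variable P : probability T R.

Lemma pr_bigcup_limit_le (F : (set T)^nat) (u : R) :
  (forall n, measurable (F n)) -> nondecreasing_seq F ->
  (forall n, pr P (F n) <= u) -> pr P (\bigcup_n F n) <= u.
Proof.
move=> mF ndF Fu; have mU : measurable (\bigcup_n F n) by exact: bigcup_measurable.
have C := nondecreasing_cvg_mu (mu := P) mF mU ndF.
rewrite -lee_fin -prE//; rewrite -(cvg_lim _ C)//.
apply: lime_le; first by apply/cvg_ex; eexists; exact: C.
by apply: nearW => n /=; rewrite prE// lee_fin.
Qed.

Lemma pr_bigcap_limit_ge (F : (set T)^nat) (u : R) :
  (forall n, measurable (F n)) -> nonincreasing_seq F ->
  (forall n, u <= pr P (F n)) -> u <= pr P (\bigcap_n F n).
Proof.
move=> mF niF Fu; have mI : measurable (\bigcap_n F n) by exact: bigcap_measurable.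
have C : P \o F @ \oo --> P (\bigcap_n F n).
  apply: nonincreasing_cvg_mu => //.
  by rewrite (le_lt_trans (probability_le1 P _)) ?ltry.
rewrite -lee_fin -prE//; rewrite -(cvg_lim _ C)//.
apply: lime_ge; first by apply/cvg_ex; eexists; exact: C.
by apply: nearW => n /=; rewrite prE// lee_fin.
Qed.

End limits.

Section quantile.
Context (R : realType).
Local Notation RR := (measurableTypeR R).
Variable P : probability RR R.

(** Stated with both half-lines since [P] may have atoms. *)
Lemma quantile_exists (u : R) : 0 < u < 1 ->
  exists t : R, pr P `]-oo, t[%classic <= u <= pr P `]-oo, t]%classic.
Proof.
move=> /andP[u0 u1]; pose E : set R := [set x | u <= pr P `]-oo, x]%classic].
have mono (x y : R) : x <= y -> pr P `]-oo, x]%classic <= pr P `]-oo, y]%classic.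
  by move=> xy; apply: le_pr => //; apply: subset_itvl; rewrite bnd_simp.
have E0 : E !=set0.
  apply: contrapT => /set0P/negP; rewrite negbK => /eqP E0.
  have : pr P (\bigcup_n `]-oo, (n%:R : R)]%classic) <= u.
    apply: pr_bigcup_limit_le => //.
      by move=> n m nm; apply/subsetPset; apply: subset_itvl; rewrite bnd_simp ler_nat.
    move=> n; rewrite leNgt; apply/negP => un.
    have : E n%:R by rewrite /E/= ltW.
    by rewrite E0.
  rewrite (_ : \bigcup_n _ = setT); last first.
    apply/seteqP; split => // x _; exists (Num.truncn x).+1 => //=.
    by rewrite in_itv/= ltW// truncnS_gt.
  by rewrite /pr probability_setT/= leNgt u1.
have Elb : has_lbound E.
  have [n nu] : exists n : nat, pr P `]-oo, (- n%:R : R)]%classic < u.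
    apply: contrapT => H.
    have : u <= pr P (\bigcap_n `]-oo, (- n%:R : R)]%classic).
      apply: pr_bigcap_limit_ge => //.
        by move=> n m nm; apply/subsetPset; apply: subset_itvl; rewrite bnd_simp lerN2 ler_nat.
      by move=> n; rewrite leNgt; apply/negP => un; apply: H; exists n.
    rewrite (_ : \bigcap_n _ = set0) ?/pr ?measure0/= ?leNgt ?u0//.
    apply/seteqP; split => // x /(_ (Num.truncn (- x)).+1 I) /=.
    by rewrite in_itv/= leNgt => /negP; apply; rewrite ltrNl truncnS_gt.
  exists (- n%:R) => x Ex; rewrite leNgt; apply/negP => /ltW/mono/le_lt_trans/(_ nu).
  by rewrite ltNge Ex.
exists (inf E); apply/andP; split.
  have -> : `]-oo, inf E[%classic = \bigcup_n `]-oo, inf E - n.+1%:R^-1]%classic.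
    apply/seteqP; split=> x /=; rewrite in_itv/=.
      by move=> /ltr_add_invr[k xk]; exists k => //=; rewrite in_itv/= lerBrDr ltW.
    by move=> [k _] /=; rewrite in_itv/= => /le_lt_trans; apply; rewrite gtrBl invr_gt0 ltr0n.
  apply: pr_bigcup_limit_le => //.
    move=> n m nm; apply/subsetPset; apply: subset_itvl; rewrite bnd_simp.
    by rewrite lerD2l lerN2 lef_pV2 ?posrE// ler_nat.
  move=> n; rewrite leNgt; apply/negP => /ltW H.
  have : inf E <= inf E - n.+1%:R^-1 by apply: ge_inf.
  by rewrite leNgt gtrBl invr_gt0 ltr0n.
rewrite (itvNycEbigcap false); apply: pr_bigcap_limit_ge => //.
  move=> n m nm; apply/subsetPset; apply: subset_itvl; rewrite bnd_simp.
  by rewrite lerD2l lef_pV2 ?posrE// ler_nat.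
move=> n; have [x Ex xE] : exists2 x, E x & x < inf E + n.+1%:R^-1.
  by apply: inf_adherent; rewrite ?invr_gt0.
by apply: (le_trans Ex); apply: mono; exact: ltW.
Qed.

End quantile.

Section half_lines.
Context (R : realType).
Local Notation RR := (measurableTypeR R).

Lemma measurable_lt_ereal (e : \bar R) : measurable [set x : RR | (x%:E < e)%E].
Proof.
case: e => [r| |].
- rewrite (_ : [set _ | _] = `]-oo, r[%classic); first exact: measurable_itv.
  by apply/seteqP; split=> x; rewrite /= in_itv/= lte_fin.
- rewrite (_ : [set _ | _] = setT); first exact: measurableT.
  by apply/seteqP; split=> x //=; rewrite ltry.
- by rewrite (_ : [set _ | _] = set0)//; apply/seteqP; split.
Qed.

Lemma measurable_gt_ereal (e : \bar R) : measurable [set x : RR | (e < x%:E)%E].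
Proof.
case: e => [r| |].
- rewrite (_ : [set _ | _] = `]r, +oo[%classic); first exact: measurable_itv.
  by apply/seteqP; split=> x; rewrite /= in_itv/= lte_fin andbT.
- by rewrite (_ : [set _ | _] = set0)//; apply/seteqP; split.
- rewrite (_ : [set _ | _] = setT); first exact: measurableT.
  by apply/seteqP; split=> x //=; rewrite ltNyr.
Qed.

Lemma measurable_le_ereal (e : \bar R) : measurable [set x : RR | (x%:E <= e)%E].
Proof.
rewrite (_ : [set _ | _] = ~` [set x : RR | (e < x%:E)%E]).
  by apply: measurableC; exact: measurable_gt_ereal.
by apply/seteqP; split=> x /=; rewrite leNgt => /negP.
Qed.

Lemma measurable_ge_ereal (e : \bar R) : measurable [set x : RR | (e <= x%:E)%E].
Proof.
rewrite (_ : [set _ | _] = ~` [set x : RR | (x%:E < e)%E]).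
  by apply: measurableC; exact: measurable_lt_ereal.
by apply/seteqP; split=> x /=; rewrite leNgt => /negP.
Qed.

Lemma measurable_oo_ereal (a b : \bar R) :
  measurable [set x : RR | (a < x%:E < b)%E].
Proof.
rewrite (_ : [set _ | _] =
  [set x : RR | (a < x%:E)%E] `&` [set x : RR | (x%:E < b)%E]).
  by apply: measurableI; [exact: measurable_gt_ereal|exact: measurable_lt_ereal].
by apply/seteqP; split=> x /= => [/andP|] [-> ->].
Qed.

Lemma measurable_cc_ereal (a b : \bar R) :
  measurable [set x : RR | (a <= x%:E <= b)%E].
Proof.
rewrite (_ : [set _ | _] =
  [set x : RR | (a <= x%:E)%E] `&` [set x : RR | (x%:E <= b)%E]).
  by apply: measurableI; [exact: measurable_ge_ereal|exact: measurable_le_ereal].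
by apply/seteqP; split=> x /= => [/andP|] [-> ->].
Qed.

Lemma measurable_interval_unions K S : @interval_unions R K S ->
  measurable (S : set RR).
Proof.
by case=> a [b [_ _ ->]]; apply: measurable_finite_union => j; exact: measurable_oo_ereal.
Qed.

End half_lines.

Section bracketing.
Context (R : realType).
Local Notation RR := (measurableTypeR R).
Variables (P : probability RR R) (N : nat).
Hypothesis N0 : (0 < N)%N.

(** The open cells of the grid have mass at most 1 / N: atoms sit on grid points. *)
Lemma quantile_grid : exists t : nat -> \bar R,
  [/\ t 0%N = -oo%E, t N = +oo%E &
    forall k, (k < N)%N ->
      pr P [set x : RR | (t k < x%:E < t k.+1)%E] <= N%:R^-1].
Proof.
have N0' : 0 < N%:R :> R by rewrite ltr0n.
have /choice[s sP] : forall k, exists t : R, (0 < k < N)%N ->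
    pr P `]-oo, t[%classic <= k%:R / N%:R <= pr P `]-oo, t]%classic.
  move=> k.
  have [kN|kN] := boolP (0 < k < N)%N; last by exists 0.
  have [|t tP] := @quantile_exists R P (k%:R / N%:R); last by exists t.
  by case/andP: kN => k0 kN; rewrite divr_gt0 ?ltr0n//= ltr_pdivrMr// mul1r ltr_nat.
pose t k := if k == 0%N then -oo%E else if k == N then +oo%E else (s k)%:E.
have tP k : (k <= N)%N -> pr P [set x : RR | (x%:E < t k)%E] <= k%:R / N%:R
    <= pr P [set x : RR | (x%:E <= t k)%E].
  rewrite /t; case: eqVneq => [-> _|k0 kN].
    rewrite mul0r pr_ge0 andbT (_ : [set _ | _] = set0) ?/pr ?measure0//.
    by apply/seteqP; split.
  case: eqVneq => [->|kN'].
    rewrite divff ?gt_eqF// pr_le1; last exact: measurable_lt_ereal.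
    rewrite (_ : [set _ | _] = setT) ?/pr ?probability_setT//=.
    by apply/seteqP; split => // x _ /=; rewrite leey.
  have := sP k; rewrite lt0n k0 ltn_neqAle kN' kN => /(_ isT).
  congr (pr P _ <= _ <= pr P _); apply/seteqP; split=> x /=;
    by rewrite in_itv/= ?lte_fin ?lee_fin.
exists t; split; [by []|by rewrite /t eqxx; case: eqP N0 => // ->|move=> k kN].
have [->|/set0P[z /= /andP[kz zk]]] := eqVneq [set x : RR | (t k < x%:E < t k.+1)%E] set0.
  by rewrite /pr measure0 /= invr_ge0 ltW.
have tkk : (t k < t k.+1)%E by exact: lt_trans kz zk.
have /andP[_ H1] := tP _ (ltnW kN); have /andP[H2 _] := tP _ kN.
have : pr P [set x : RR | (x%:E <= t k)%E] + pr P [set x : RR | (t k < x%:E < t k.+1)%E]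
    <= pr P [set x : RR | (x%:E < t k.+1)%E].
  rewrite -pr_setU; [|exact: measurable_le_ereal|exact: measurable_oo_ereal|].
    apply: le_pr; [|exact: measurable_lt_ereal|].
      by apply: measurableU; [exact: measurable_le_ereal|exact: measurable_oo_ereal].
    by move=> x [/= /le_lt_trans|/andP[]//]; apply.
  apply/disj_set2P/seteqP; split=> // x [/= xk /andP[kx _]].
  by move: xk; rewrite leNgt kx.
move: H1 H2; rewrite -natr1 mulrDl mul1r; lra.
Qed.

(** An endpoint [a] is moved to the two ends of the grid cell that contains it, so
    an interval (a, b) is bracketed by an open interval and a closed one, both
    with endpoints in the grid; the difference lies in the cells of [a] and [b]. *)
Lemma interval_unions_bracketing K :
  exists L U : {ffun 'I_K -> 'I_N * 'I_N} -> set RR,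
  (forall i, [/\ measurable (L i), measurable (U i) &
     pr P (U i) <= pr P (L i) + (2 * K)%:R / N%:R]) /\
  (forall S, interval_unions K S -> exists i, L i `<=` S /\ S `<=` U i).
Proof.
have [t [t0 tN tP]] := quantile_grid.
pose L (i : {ffun 'I_K -> 'I_N * 'I_N}) :=
  \bigcup_j [set x : RR | (t (i j).1.+1 <= x%:E <= t (i j).2)%E].
pose U (i : {ffun 'I_K -> 'I_N * 'I_N}) :=
  \bigcup_j [set x : RR | (t (i j).1 < x%:E < t (i j).2.+1)%E].
pose c (k : 'I_N) := [set x : RR | (t k < x%:E < t k.+1)%E].
have mL i : measurable (L i).
  by apply: measurable_finite_union => j; exact: measurable_cc_ereal.
have mU i : measurable (U i).
  by apply: measurable_finite_union => j; exact: measurable_oo_ereal.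
have mc k : measurable (c k) by exact: measurable_oo_ereal.
have mcc (i : {ffun 'I_K -> 'I_N * 'I_N}) : measurable (\bigcup_j (c (i j).1 `|` c (i j).2)).
  by apply: measurable_finite_union => j; exact: measurableU.
exists L, U; split=> [i|S [a [b [_ _ ->]]]].
  split=> //.
  have UL : U i `<=` L i `|` \bigcup_j (c (i j).1 `|` c (i j).2).
    move=> x [j _ /= /andP[x1 x2]].
    have [h1|h1] := leP (t (i j).1.+1) x%:E; last first.
      by right; exists j => //; left; rewrite /c/= x1 h1.
    have [h2|h2] := leP x%:E (t (i j).2); last first.
      by right; exists j => //; right; rewrite /c/= x2 h2.
    by left; exists j => //=; rewrite h1 h2.
  apply: (le_trans (le_pr P (mU i) _ UL)); first exact: measurableU.
  apply: (le_trans (pr_setU_le _ _ _)) => //; rewrite lerD2l.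
  apply: (le_trans (pr_bigcup_le _ _)) => [j|]; first exact: measurableU.
  apply: (@le_trans _ _ (\sum_(j < K) (N%:R^-1 + N%:R^-1))).
    apply: ler_sum => j _; apply: (le_trans (pr_setU_le _ _ _)) => //.
    by apply: lerD; exact: tP.
  by rewrite sumr_const card_ord -[X in X <= _]mulr_natr natrM le_eqVlt; apply/orP; left; apply/eqP; ring.
have /choice[f fP] : forall j, exists k : 'I_N, (t k <= a j)%E /\
    forall x : R, (t k.+1 <= x%:E -> a j < x%:E)%E.
  move=> j.
  have H0 : (t (Ordinal N0) <= a j)%E by rewrite t0 leNye.
  case: (@arg_maxnP _ (Ordinal N0) (fun k : 'I_N => t k <= a j)%E val H0) => k kP kmax.
  exists k; split=> // x; have [kN|] := ltnP k.+1 N.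
    apply: lt_le_trans; rewrite ltNge; apply/negP => H.
    by have := kmax (Ordinal kN) H; rewrite /= ltnn.
  rewrite leq_eqVlt ltnS leqNgt (ltn_ord k) orbF => /eqP <-.
  by rewrite tN leye_eq.
have /choice[g gP] : forall j, exists k : 'I_N, (b j <= t k.+1)%E /\
    forall x : R, (x%:E <= t k -> x%:E < b j)%E.
  move=> j.
  have lN : (N.-1 < N)%N by rewrite prednK.
  have H0 : (b j <= t (Ordinal lN).+1)%E by rewrite /= prednK// tN leey.
  case: (@arg_minnP _ (Ordinal lN) (fun k : 'I_N => b j <= t k.+1)%E val H0) => k kP kmin.
  exists k; split=> // x; case: (posnP k) => [->|k0]; first by rewrite t0 leeNy_eq.
  move=> /le_lt_trans; apply; rewrite ltNge; apply/negP => H.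
  have kN : (k.-1 < N)%N by apply: leq_ltn_trans (leq_pred _) (ltn_ord k).
  have := kmin (Ordinal kN); rewrite /= prednK// => /(_ H).
  by rewrite -[X in (X <= _)%N]prednK// ltnn.
exists [ffun j => (f j, g j)]; split.
  move=> x [j _ /=]; rewrite ffunE/= => /andP[x1 x2]; exists j => //=.
  by rewrite (fP j).2//= (gP j).2.
move=> x [j _ /= /andP[x1 x2]]; exists j => //=; rewrite ffunE/=.
by rewrite (le_lt_trans (fP j).1 x1) (lt_le_trans x2 (gP j).1).
Qed.

End bracketing.

(** * From deviations to the upper confidence bound *)

Section cover.
Context d (T : measurableType d) (R : realType).

(** The integrand may fail to be measurable, as can happen for a test that
    quantifies over uncountably many sets; its integral is then an inner one,
    and a measurable majorant still bounds it. *)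
Lemma expectation_le_pr (P : probability T R) (X : T -> R) (B : set T) :
  measurable B -> (forall z, 0 <= X z <= \1_B z) ->
  ('E_P[X] <= (pr P B)%:E)%E.
Proof.
move=> mB XB; rewrite -prE// -expectation_indic// expectation.unlock.
rewrite !ge0_integralTE; last 2 first.
- by move=> z; rewrite lee_fin indicE.
- by move=> z; rewrite lee_fin; case/andP: (XB z).
apply: le_ereal_sup => _ [h hX <-]; exists h => // z.
by apply: le_trans (hX z) _; rewrite lee_fin; case/andP: (XB z).
Qed.

End cover.

Section deviations.
Context d (T : measurableType d) (R : realType).
Variable P : probability T R.

(** The lower deviations of [L i] yield the branch sqrt (tau t) of [h_plus], the
    upper deviations of its complement the branch sqrt (tau (1 - t)). *)
Definition bad_samples n (t : R) (I : finType) (L : I -> set T) : set (n.-tuple T) :=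
  \bigcup_i (lower_dev P t (L i) `|` upper_dev P t (~` L i)).

Lemma measurable_bad_samples n t (I : finType) (L : I -> set T) :
  (forall i, measurable (L i)) -> measurable (@bad_samples n t I L).
Proof.
move=> mL; apply: measurable_finite_union => i; apply: measurableU.
  exact: measurable_lower_dev.
by apply: measurable_upper_dev; exact: measurableC.
Qed.

Lemma pr_bad_samples n t (I : finType) (L : I -> set T) :
  (0 < n)%N -> 0 < t -> (forall i, measurable (L i)) ->
  pr (iid_law P n) (@bad_samples n t I L) <=
    (2 * #|I|)%:R * expR (n%:R * (- (t / 2))).
Proof.
move=> n0 t0 mL.
have mlow i : measurable (@lower_dev _ _ _ P n t (L i)) by exact: measurable_lower_dev.
have mup i : measurable (@upper_dev _ _ _ P n t (~` L i)).
  by apply: measurable_upper_dev; exact: measurableC.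
apply: (le_trans (pr_bigcup_le _ _)) => [i|]; first exact: measurableU.
apply: (@le_trans _ _ (\sum_(i : I) (2 * expR (n%:R * (- (t / 2)))))).
  apply: ler_sum => i _; apply: (le_trans (pr_setU_le _ _ _)) => //.
  rewrite mulr_natl mulr2n lerD//; first exact: lower_tail.
  by apply: upper_tail => //; exact: measurableC.
by rewrite sumr_const -[X in X <= _]mulr_natr natrM le_eqVlt; apply/orP; left; apply/eqP; ring.
Qed.

End deviations.

Section h_plus.
Context (R : realType).
Implicit Types (tau eta p q : R).

(** Here [p] and [q] are the mass and the frequency of a set, [pA] and [qA] those
    of a superset whose mass is larger by at most [eta]. *)
Lemma le_h_plus tau eta p pA q qA : 0 < tau -> eta <= tau / 4 ->
  0 <= p -> pA <= p + eta -> pA <= 1 -> 0 <= q -> q <= qA -> qA <= 1 ->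
  p - q <= Num.sqrt (3 / 4 * tau * p) ->
  p - q <= Num.sqrt (3 / 4 * tau * (1 - q)) ->
  pA <= h_plus tau qA.
Proof.
move=> tau0 eta_le p0 pA_le pA1 q0 qqA qA1 Hlow Hup.
have t0 : 0 <= 3 / 4 * tau by lra.
set t := 3 / 4 * tau in Hlow Hup t0 *.
have tE : t = 3 / 4 * tau by [].
have le_sqrt (x y : R) : 0 <= y -> x <= y -> Num.sqrt (t * x) <= Num.sqrt (tau * y).
  move=> y0 xy; rewrite ler_wsqrtr//.
  have : t * x <= t * y by rewrite ler_wpM2l.
  by rewrite tE; nra.
have sqr_sqrt_t (x : R) : 0 <= x -> Num.sqrt (t * x) ^+ 2 = t * x.
  by move=> x0; rewrite sqr_sqrtr// mulr_ge0.
rewrite /h_plus le_min pA1 andbT /V.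
have -> : Num.max (1 - qA) 0 = 1 - qA by apply/max_idPl; lra.
rewrite minEle; case: ifP => _.
  (* the quadratic inequality p - q <= sqrt (t p) solved for p *)
- have : p <= q + Num.sqrt (t * q) + t.
    have := sqr_sqrt_t _ p0; have := sqr_sqrt_t _ q0; move: Hlow.
    have := sqrtr_ge0 (t * p); have := sqrtr_ge0 (t * q).
    set a := Num.sqrt (t * p); set b := Num.sqrt (t * q) => b0 a0 H b2 a2.
    rewrite leNgt; apply/negP => H'.
    have aB : b + t < a by lra.
    have : a ^+ 2 <= t * q + t * a by rewrite a2 -mulrDr ler_wpM2l//; lra.
    by nra.
  have := le_sqrt q qA (le_trans q0 qqA) qqA; lra.
  (* sqrt is subadditive, and sqrt (t d) <= t / 4 + d *)
- set dq := qA - q; have dq0 : 0 <= dq by rewrite /dq; lra.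
  have h1 : 0 <= 1 - qA by lra.
  have : Num.sqrt (t * (1 - q)) <= Num.sqrt (t * (1 - qA)) + (t / 4 + dq).
    have nn : 0 <= Num.sqrt (t * (1 - qA)) + (t / 4 + dq).
      by have := sqrtr_ge0 (t * (1 - qA)); lra.
    rewrite -[leRHS]ger0_norm//.
    rewrite -sqrtr_sqr ler_wsqrtr//.
    have := sqr_sqrt_t _ h1; have := sqrtr_ge0 (t * (1 - qA)).
    set a := Num.sqrt _ => a0 a2.
    have -> : t * (1 - q) = t * (1 - qA) + t * dq by rewrite /dq; ring.
    have := sqr_ge0 (t / 4 - dq); nra.
  have := le_sqrt (1 - qA) (1 - qA) h1 (lexx _); rewrite /dq; lra.
Qed.

(** It suffices to control deviations of the inner brackets: enlarging a set can
    only increase its frequency, and its mass increases by at most [eta]. *)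
Lemma le_pr_h_plus d (T : measurableType d) (P : probability T R) n tau eta
    (I : finType) (L : I -> set T) (i : I) (A : set T) (x : n.-tuple T) :
  (0 < n)%N -> 0 < tau -> eta <= tau / 4 -> measurable (L i) -> measurable A ->
  L i `<=` A -> pr P A <= pr P (L i) + eta ->
  ~ bad_samples P (3 / 4 * tau) L x ->
  pr P A <= h_plus tau (freq A x).
Proof.
move=> n0 tau0 eta_le mL mA LA PA bad.
apply: (@le_h_plus tau eta (pr P (L i)) _ (freq (L i) x)) => //.
- exact: pr_ge0.
- exact: pr_le1.
- exact: freq_ge0.
- exact: le_freq.
- exact: freq_le1.
- by rewrite leNgt; apply/negP => H; apply: bad; exists i => //; left.
- rewrite leNgt; apply/negP => H; apply: bad; exists i => //; right.
  by rewrite /upper_dev /= freq_setC// pr_setC//; move: H; lra.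
Qed.

End h_plus.

(** * Numerical constraints on tau and the level of the test *)

Section numerics.
Context (R : realType).

Lemma expR1_le4 : expR 1 <= 4 :> R.
Proof.
have h : expR 1 = expR (2^-1) ^+ 2 :> R by rewrite -expRM_natl mulfV.
have : 2^-1 * expR (2^-1) <= 1 :> R.
  rewrite -ler_pdivlMr ?expR_gt0// mul1r -expRN.
  by have := expR_ge1Dx (- 2^-1 : R); lra.
by rewrite h; have := expR_ge0 (2^-1 : R); nra.
Qed.

Lemma ln_ge1 (x : R) : 4 <= x -> 1 <= ln x.
Proof.
move=> x4; rewrite -[1]expRK ler_ln ?posrE ?expR_gt0//; last by lra.
exact: le_trans expR1_le4 _.
Qed.

Variables (delta : R) (hdelta : 0 < delta < 1).

Lemma ln_delta_ge1 : 1 <= ln (32 / delta).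
Proof.
case/andP: hdelta => d0 d1; apply: ln_ge1.
by rewrite ler_pdivlMr//; lra.
Qed.

Lemma tauE K n : tau (@interval_unions R K) n delta =
  4 * ((2 * K)%:R * ln (2 * n%:R) + ln (32 / delta)) / n%:R.
Proof. by rewrite /tau vc_dim_interval_unions. Qed.

Lemma ln2n_ge0 n : (0 < n)%N -> 0 <= ln (2 * n%:R : R).
Proof. 
move=> n0; apply: ln_ge0; have : 1 <= n%:R :> R by rewrite ler1n.
lra.
Qed.

(** The bound on [tau] forces n >= 8. *)
Lemma ln2n_ge1 K n : (0 < n)%N -> tau (@interval_unions R K) n delta <= 1 / 2 ->
  1 <= ln (2 * n%:R : R).
Proof.
move=> n0; rewrite tauE ler_pdivrMr ?ltr0n// => H.
apply: ln_ge1; have := ln2n_ge0 n0; have := ln_delta_ge1.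
have : 0 <= (2 * K)%:R :> R by [].
move: H; set L := ln _; set D := ln _; set k := (2 * K)%:R => H k0 D1 L0.
have : 0 <= k * L by exact: mulr_ge0.
by move: H; lra.
Qed.

Lemma tau_gt0 K n : (0 < n)%N -> 0 < tau (@interval_unions R K) n delta.
Proof.
move=> n0; rewrite tauE divr_gt0 ?ltr0n// mulr_gt0//.
by rewrite ltr_wpDl ?mulr_ge0 ?ln2n_ge0//; have := ln_delta_ge1; lra.
Qed.

Lemma bracketing_error_le K n : (0 < n)%N ->
  tau (@interval_unions R K) n delta <= 1 / 2 ->
  (2 * K)%:R / n%:R <= tau (@interval_unions R K) n delta / 4.
Proof.
move=> n0 tau12; have L1 := ln2n_ge1 n0 tau12.
rewrite tauE [leRHS]mulrAC [4 * _]mulrC mulfK// ler_wpM2r ?invr_ge0//.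
have : 0 <= (2 * K)%:R :> R by [].
have := ln_delta_ge1; nra.
Qed.

(** The n^(2 K) brackets are paid for by the factor (2 n)^(- 3 K) of the tail. *)
Lemma union_bound_le K n : (0 < n)%N ->
  (2 * #|{ffun 'I_K -> 'I_n * 'I_n}|)%:R *
   expR (n%:R * - (3 / 4 * tau (@interval_unions R K) n delta / 2)) <= delta / 2.
Proof.
move=> n0; have n0' : 0 < n%:R :> R by rewrite ltr0n.
rewrite tauE; have := ln_delta_ge1; have := ln2n_ge0 n0.
set L := ln _; set D := ln _ => L0 D1.
have -> : n%:R * - (3 / 4 * (4 * ((2 * K)%:R * L + D) / n%:R) / 2) =
  - (3 / 2 * ((2 * K)%:R * L + D)) by field; rewrite gt_eqF.
rewrite card_ffun card_prod !card_ord mulnn -expnM natrM natrX.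
have nE : n%:R ^+ (2 * K) <= expR ((2 * K)%:R * L).
  rewrite expRM_natl lerXn2r ?nnegrE ?expR_ge0//.
  by rewrite lnK ?posrE ?mulr_gt0//; lra.
have dE : expR (- D) = delta / 32.
  case/andP: hdelta => d0 d1.
  by rewrite expRN lnK ?posrE ?divr_gt0// invf_div.
apply: (@le_trans _ _ (2 * (expR ((2 * K)%:R * L) * expR (- (3 / 2 * ((2 * K)%:R * L + D)))))).
  by rewrite -mulrA ler_wpM2l// ler_wpM2r// expR_ge0.
rewrite -expRD; apply: (@le_trans _ _ (2 * expR (- D))).
  rewrite ler_wpM2l// ler_expR; have : 0 <= (2 * K)%:R * L by rewrite mulr_ge0.
  lra.
by rewrite dE; case/andP: hdelta => d0 d1; lra.
Qed.

End numerics.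

Section product_events.
Context d1 d2 (T1 : measurableType d1) (T2 : measurableType d2) (R : realType).
Variables (P : probability T1 R) (Q : probability T2 R).

(** For errors that can only occur when one of the two samples is atypical. *)
Lemma expectation_le_pr_either (X : T1 * T2 -> R) B1 B2 :
  measurable B1 -> measurable B2 -> (forall z, 0 <= X z <= 1) ->
  (forall z, ~ B1 z.1 -> ~ B2 z.2 -> X z = 0) ->
  ('E_(P \x Q)[X] <= (pr P B1 + pr Q B2)%:E)%E.
Proof.
move=> mB1 mB2 X01 XB.
have m1 : measurable (B1 `*` [set: T2]) by exact: measurableX.
have m2 : measurable ([set: T1] `*` B2) by exact: measurableX.
apply: (@le_trans _ _ (pr (P \x Q)%E (B1 `*` setT `|` setT `*` B2))%:E).
  apply: expectation_le_pr; first exact: measurableU.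
  move=> z; case/andP: (X01 z) => -> Xz1 /=; rewrite indicE.
  case: (boolP (_ \in _)) => // /negP zB; rewrite XB// => Bz; apply: zB; rewrite inE.
    by left.
  by right.
rewrite lee_fin; apply: (le_trans (pr_setU_le _ m1 m2)).
have prT d (T : measurableType d) (S : probability T R) : pr S setT = 1.
  by rewrite /pr probability_setT.
rewrite lerD// -lee_fin -prE//.
  by apply: (eq_ind_r (fun v => v <= _)%E _ (product_prE P Q mB1 measurableT)); rewrite prT mulr1.
by apply: (eq_ind_r (fun v => v <= _)%E _ (product_prE P Q measurableT mB2)); rewrite prT mul1r.
Qed.

End product_events.

Section type_one_error.
Context (R : realType).
Local Notation RR := (measurableTypeR R).

(** For [P] the brackets approximate S from inside; for [Q] the set of interest is
    the complement of S, whose inner brackets are the complements of the outer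
    brackets of S. *)
Lemma type_one_error (delta : R) K n (P Q : probability RR R) (eps1 : R) :
  0 < delta < 1 -> (0 < n)%N ->
  tau (@interval_unions R K) n delta <= 1 / 2 ->
  (tv_dist P Q <= eps1%:E)%E ->
  ('E_(iid_law P n \x iid_law Q n)[psi (@interval_unions R K) (g_tv eps1) n delta]
    <= delta%:E)%E.
Proof.
move=> hdelta n0 tau12 PQ; set t := tau _ _ _ in tau12.
have t0 : 0 < t by exact: tau_gt0.
have t34 : 0 < 3 / 4 * t by lra.
have [LP [UP [LPm LPS]]] := interval_unions_bracketing P n0 K.
have [LQ [UQ [LQm LQS]]] := interval_unions_bracketing Q n0 K.
have mLP i : measurable (LP i) by case: (LPm i).
have mUQ i : measurable (~` (UQ i)) by apply: measurableC; case: (LQm i).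
have mB1 : measurable (bad_samples P (3 / 4 * t) LP (n := n)) by exact: measurable_bad_samples.
have mB2 : measurable (bad_samples Q (3 / 4 * t) (fun i => ~` (UQ i)) (n := n)).
  exact: measurable_bad_samples.
have := @expectation_le_pr_either _ _ _ _ _ (iid_law P n) (iid_law Q n)
  (psi (@interval_unions R K) (g_tv eps1) n delta) _ _ mB1 mB2.
move=> /(_ _ _)/le_trans; apply.
- by move=> z; rewrite /psi indicE; case: (_ \in _); rewrite ?lexx ler01.
- move=> z z1 z2; rewrite /psi indicE memNset//= => -[S SS].
  have mS := measurable_interval_unions SS.
  have [i [LPi UPi]] := LPS _ SS; have [j [LQj UQj]] := LQS _ SS.
  have HP : pr P S <= h_plus t (empirical z.1 S).
    have [_ mU LUi] := LPm i.
    apply: (le_pr_h_plus (i := i) (eta := (2 * K)%:R / n%:R) n0 t0 _ _ _ LPi _ z1) => //.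
      exact: bracketing_error_le.
    by apply: le_trans LUi; exact: le_pr.
  have HQ : pr Q (~` S) <= h_plus t (empirical z.2 (~` S)).
    have [_ mU LUj] := LQm j.
    apply: (le_pr_h_plus (i := j) (eta := (2 * K)%:R / n%:R) n0 t0 _ _ _ _ _ z2) => //.
    - exact: bracketing_error_le.
    - exact: measurableC.
    - exact: subsetC.
    - have [mL _ _] := LQm j; rewrite !pr_setC//.
      by have := le_pr Q mL mS LQj; move: LUj; lra.
  have tvS : pr P (~` S) - pr Q (~` S) <= eps1.
    have mSc : measurable (~` S : set RR) by exact: measurableC.
    rewrite -lee_fin; apply: le_trans PQ.
    apply: (@le_trans _ _ `|P (~` S) - Q (~` S)|%E).
      by rewrite !prE// -EFinB lee_fin ler_norm.
    by apply: ereal_sup_ubound; exists (~` S).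
  have := pr_ge0 Q (~` S).
  move: tvS; rewrite pr_setC// -/t /g_tv; move: HP HQ.
  set a := h_plus _ _; set b := h_plus _ _ => HP HQ tvS Q0.
  by rewrite lt_max; case/orP; lra.
rewrite lee_fin.
have := pr_bad_samples P n0 t34 mLP; have := pr_bad_samples Q n0 t34 mUQ.
have := union_bound_le hdelta K n0; rewrite -/t; lra.
Qed.

End type_one_error.

(** * Mass bounds for measures with a density *)

Section exponential_integral.
Context (R : realType).

Local Notation RR := (measurableTypeR R).

Lemma measurable_expR_affine (s x : R) (A : set RR) :
  measurable_fun A (fun z : RR => expR (s * (z - x))).
Proof.
apply: measurable_funTS; apply: continuous_measurable_fun => z.
have df (w : R) : derivable (fun z => expR (s * (z - x))) w 1 by [].
exact/differentiable_continuous/derivable1_diffP.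
Qed.

Lemma measurable_EFin_expR_affine (s x : R) (A : set RR) :
  measurable_fun A (fun z : RR => (expR (s * (z - x)))%:E).
Proof.
have : measurable_fun A (EFin \o (fun z : RR => expR (s * (z - x)))).
  by apply/measurable_EFinP; exact: measurable_expR_affine.
by [].
Qed.

Lemma integral_expR_affine (s x u v : R) : s != 0 -> u < v ->
  (\int[lebesgue_measure]_(z in `[u, v]) (expR (s * (z - x)))%:E =
   ((expR (s * (v - x)) - expR (s * (u - x))) / s)%:E)%E.
Proof.
move=> s0 uv; pose F z : R := expR (s * (z - x)) / s.
have dF (z : R) : is_derive z 1 F (expR (s * (z - x))).
  by rewrite /F; apply: is_derive_eq; rewrite /GRing.scale /=; field.
have cF : continuous F.
  by move=> z; exact/differentiable_continuous/derivable1_diffP.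
have cf : continuous (fun z => expR (s * (z - x))).
  have df (w : R) : derivable (fun z => expR (s * (z - x))) w 1 by [].
  by move=> z; exact/differentiable_continuous/derivable1_diffP.
rewrite (@continuous_FTC2 _ _ F)//.
- by rewrite /F mulrBl EFinB.
- exact: continuous_subspaceT.
- split=> [z _|  |].
  + by [].
  + by apply: cvg_at_right_filter; exact: cF.
  + by apply: cvg_at_left_filter; exact: cF.
- by move=> z _; rewrite derive1E derive_val.
Qed.

End exponential_integral.

Section density.
Context (R : realType).
Local Notation RR := (measurableTypeR R).
Local Notation mu := (@lebesgue_measure R).
Variables (P : probability RR R) (p : RR -> R).
Hypotheses (mp : measurable_fun setT p) (p0 : forall x, 0 <= p x).
Hypothesis Pp : forall A, measurable A -> P A = (\int[mu]_(x in A) (p x)%:E)%E.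

Let mpE A : measurable_fun A (EFin \o p).
Proof. by apply/measurable_EFinP; exact: measurable_funTS. Qed.

Lemma pr_le_integral (A : set RR) (f : RR -> R) (c : R) : measurable A ->
  measurable_fun A f -> (forall x, A x -> p x <= f x) ->
  (\int[mu]_(x in A) (f x)%:E <= c%:E)%E -> pr P A <= c.
Proof.
move=> mA mf pf fc; rewrite -lee_fin -prE// Pp//; apply: le_trans fc.
have mEf : measurable_fun A (EFin \o f) by exact/measurable_EFinP.
by apply: ge0_le_integral => // x _; rewrite lee_fin.
Qed.

Lemma integral_cst_itv (a b c : R) : a <= b ->
  (\int[mu]_(x in `[a, b]) c%:E = (c * (b - a))%:E)%E.
Proof.
move=> ab; transitivity (c%:E * mu `[a, b]%classic)%E; first exact: integral_cst.
rewrite lebesgue_measure_itv/= lte_fin.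
have [ab'|ba] := ltP a b; first by rewrite -EFinB -EFinM.
by have -> : b = a; [lra|rewrite subrr mulr0 mule0].
Qed.

Lemma pr_itv_le (a b c : R) : a <= b -> (forall x, a <= x <= b -> p x <= c) ->
  pr P `[a, b]%classic <= c * (b - a).
Proof.
move=> ab pc; apply: (@pr_le_integral _ (cst c)) => //.
by rewrite integral_cst_itv.
Qed.

Lemma pr_itv_ge (a b c : R) : a <= b -> 0 <= c ->
  (forall x, a <= x <= b -> c <= p x) -> c * (b - a) <= pr P `[a, b]%classic.
Proof.
move=> ab c0 pc; rewrite -lee_fin -prE// Pp// -integral_cst_itv//.
by apply: ge0_le_integral => //; exact: mpE.
Qed.

Lemma pr_set1 (x : R) : pr P [set x] = 0.
Proof.
apply/eqP; rewrite eq_le pr_ge0 andbT -set_itv1.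
by have := @pr_itv_le x x (p x) (lexx _); rewrite subrr mulr0; apply => z /le_anti ->.
Qed.

Lemma quantile_eq (u : R) : 0 < u < 1 -> exists t : R, pr P `]-oo, t]%classic = u.
Proof.
move=> /(quantile_exists P)[t /andP[tu ut]]; exists t.
apply/eqP; rewrite eq_le ut andbT; apply: le_trans tu.
have -> : `]-oo, t]%classic = `]-oo, t[%classic `|` [set t].
  by rewrite setUitv1.
by rewrite (le_trans (pr_setU_le _ _ _))// pr_set1 addr0.
Qed.

Lemma exponential_left_tail (x s c : R) : 0 < s -> 0 <= c ->
  (forall z, z <= x -> p z <= c * expR (s * (z - x))) ->
  s * pr P `]-oo, x]%classic <= c.
Proof.
move=> s0 c0 pc; rewrite mulrC -ler_pdivlMr//.
have -> : `]-oo, x]%classic = \bigcup_n `[x - n.+1%:R, x]%classic.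
  apply/seteqP; split=> z /=; rewrite in_itv/=.
    move=> zx; exists (Num.truncn (x - z)) => //=; rewrite in_itv/= zx andbT.
    by rewrite lerBlDl -lerBlDr ltW// truncnS_gt.
  by move=> [n _] /=; rewrite in_itv/= => /andP[].
apply: pr_bigcup_limit_le => // [n m nm|n].
  apply/subsetPset; apply: subset_itvr; rewrite bnd_simp.
  by rewrite lerD2l lerN2 ler_nat.
have xn : x - n.+1%:R < x by rewrite gtrBl ltr0n.
apply: (@pr_le_integral _ (fun z => c * expR (s * (z - x)))) => //.
- by apply: measurable_funM => //; exact: measurable_expR_affine.
- by move=> z /=; rewrite in_itv/= => /andP[_]; exact: pc.
under eq_integral do rewrite EFinM.
rewrite ge0_integralZl//; last exact: measurable_EFin_expR_affine.
rewrite integral_expR_affine ?gt_eqF// -EFinM lee_fin ler_wpM2l//.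
rewrite subrr mulr0 expR0 ler_pdivrMr// mulVf ?gt_eqF//.
Qed.

Lemma exponential_right_tail (x s c : R) : 0 < s -> 0 <= c ->
  (forall z, x <= z -> p z <= c * expR (- s * (z - x))) ->
  s * pr P `[x, +oo[%classic <= c.
Proof.
move=> s0 c0 pc; rewrite mulrC -ler_pdivlMr//.
have -> : `[x, +oo[%classic = \bigcup_n `[x, x + n.+1%:R]%classic.
  apply/seteqP; split=> z /=; rewrite in_itv/= ?andbT.
    move=> zx; exists (Num.truncn (z - x)) => //=; rewrite in_itv/= zx/=.
    by rewrite -lerBlDl ltW// truncnS_gt.
  by move=> [n _] /=; rewrite in_itv/= => /andP[].
apply: pr_bigcup_limit_le => // [n m nm|n].
  apply/subsetPset; apply: subset_itvl; rewrite bnd_simp.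
  by rewrite lerD2l ler_nat.
have xn : x < x + n.+1%:R by rewrite ltrDl ltr0n.
apply: (@pr_le_integral _ (fun z => c * expR (- s * (z - x)))) => //.
- by apply: measurable_funM => //; exact: measurable_expR_affine.
- by move=> z /=; rewrite in_itv/= => /andP[+ _]; exact: pc.
under eq_integral do rewrite EFinM.
rewrite ge0_integralZl//; last exact: measurable_EFin_expR_affine.
rewrite integral_expR_affine ?oppr_eq0 ?gt_eqF// -EFinM lee_fin ler_wpM2l//.
rewrite subrr mulr0 expR0 invrN mulrN -mulNr opprB ler_pdivrMr// mulVf ?gt_eqF//.
Qed.

End density.

(** * Secants of log-concave densities *)

Section log_concave.
Context (R : realType).
Local Notation RR := (measurableTypeR R).
Variable p : R -> R.
Hypothesis lc : log_concave p.

Lemma log_concave_conv (x y t : R) : 0 <= t -> t <= 1 -> 0 < p x -> 0 < p y ->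
  0 < p (t * x + (1 - t) * y) /\
  t * ln (p x) + (1 - t) * ln (p y) <= ln (p (t * x + (1 - t) * y)).
Proof.
move=> t0 t1 px py; case: lc => cs cf.
have xs : (x : R^o) \in [set x : R^o | 0 < p x] by rewrite inE.
have ys : (y : R^o) \in [set x : R^o | 0 < p x] by rewrite inE.
split; first by have := cs _ _ (Itv01 t0 t1) xs ys; rewrite inE.
have := cf (Itv01 t0 t1) _ _ xs ys.
rewrite !convRE /= !mulrN -opprD lerN2.
by [].
Qed.

Lemma log_concave_between (x z y : R) : x <= z <= y -> 0 < p x -> 0 < p y ->
  0 < p z /\ (y - z) * ln (p x) + (z - x) * ln (p y) <= (y - x) * ln (p z).
Proof.
move=> /andP[xz zy] px py; have [xy|yx] := ltP x y; last first.
  have -> : z = x by apply/eqP; rewrite eq_le xz andbT (le_trans zy).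
  have -> : y = x by apply/eqP; rewrite eq_le yx (le_trans xz).
  by rewrite subrr !mul0r addr0.
have yx0 : 0 < y - x by rewrite subr_gt0.
pose t := (y - z) / (y - x).
have t0 : 0 <= t by rewrite divr_ge0 ?subr_ge0// ltW.
have t1 : t <= 1 by rewrite ler_pdivrMr// mul1r lerD2l lerN2.
have tz : t * x + (1 - t) * y = z by rewrite /t; field; rewrite gt_eqF.
have [] := log_concave_conv t0 t1 px py; rewrite tz => pz H; split=> //.
rewrite -(ler_pM2l yx0) in H; apply: le_trans H.
by rewrite /t le_eqVlt; apply/orP; left; apply/eqP; field; rewrite gt_eqF.
Qed.

End log_concave.

Section log_concave_distribution.
Context (R : realType).
Local Notation RR := (measurableTypeR R).
Local Notation mu := (@lebesgue_measure R).
Variables (P : probability RR R) (p : RR -> R).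
Hypotheses (mp : measurable_fun setT p) (p0 : forall x, 0 <= p x).
Hypothesis lc : log_concave p.
Hypothesis Pp : forall A, measurable A -> P A = (\int[mu]_(x in A) (p x)%:E)%E.

Lemma density_gt0_exists (A : set RR) : measurable A -> 0 < pr P A ->
  exists2 x, A x & 0 < p x.
Proof.
move=> mA PA; apply: contrapT => H.
have : pr P A <= 0.
  rewrite -lee_fin -prE// Pp// integral0_eq// => x Ax; congr EFin.
  apply/eqP; rewrite eq_le p0 andbT leNgt; apply/negP => px.
  by apply: H; exists x.
by rewrite leNgt PA.
Qed.

Lemma density_gt0 (x : R) : 0 < pr P `]-oo, x]%classic ->
  0 < pr P `[x, +oo[%classic -> 0 < p x.
Proof.
move=> /density_gt0_exists[//|u /= + pu]; rewrite in_itv/= => ux.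
move=> /density_gt0_exists[//|v /= + pv]; rewrite in_itv/= andbT => xv.
by have [] := @log_concave_between _ _ lc u x v; rewrite ?ux.
Qed.

(** Left of [x] the density lies below the exponential that extends the secant
    through [x] and [y], whose integral is [p x] divided by the slope. *)
Lemma secant_left_tail (x y : R) : x < y -> 0 < p x -> 0 < p y ->
  (ln (p y) - ln (p x)) * pr P `]-oo, x]%classic <= p x * (y - x).
Proof.
move=> xy px py; have yx : 0 < y - x by rewrite subr_gt0.
have [D0|D0] := leP (ln (p y) - ln (p x)) 0.
  apply: (@le_trans _ _ 0); first by rewrite mulr_le0_ge0// pr_ge0.
  by rewrite mulr_ge0// ltW.
set s := (ln (p y) - ln (p x)) / (y - x); have s0 : 0 < s by rewrite divr_gt0.
have -> : ln (p y) - ln (p x) = s * (y - x) by rewrite /s divfK// gt_eqF.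
rewrite mulrAC ler_pM2r//; apply: (exponential_left_tail mp p0 Pp s0 (ltW px)) => z zx.
have := p0 z; rewrite le_eqVlt => /predU1P[<-|pz].
  by rewrite mulr_ge0 ?expR_ge0// ltW.
rewrite -[X in X <= _]lnK ?posrE// -[p x in leRHS]lnK ?posrE// -expRD ler_expR.
have [|_ H] := @log_concave_between _ _ lc z x y _ pz py; first by rewrite zx ltW.
rewrite -(ler_pM2l yx) mulrDr /s mulrA [(y - x) * (_ / _)]mulrC divfK ?gt_eqF//.
move: H; lra.
Qed.

Lemma secant_right_tail (x y : R) : x < y -> 0 < p x -> 0 < p y ->
  (ln (p x) - ln (p y)) * pr P `[y, +oo[%classic <= p y * (y - x).
Proof.
move=> xy px py; have yx : 0 < y - x by rewrite subr_gt0.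
have [D0|D0] := leP (ln (p x) - ln (p y)) 0.
  apply: (@le_trans _ _ 0); first by rewrite mulr_le0_ge0// pr_ge0.
  by rewrite mulr_ge0// ltW.
set s := (ln (p x) - ln (p y)) / (y - x); have s0 : 0 < s by rewrite divr_gt0.
have -> : ln (p x) - ln (p y) = s * (y - x) by rewrite /s divfK// gt_eqF.
rewrite mulrAC ler_pM2r//; apply: (exponential_right_tail mp p0 Pp s0 (ltW py)) => z yz.
have := p0 z; rewrite le_eqVlt => /predU1P[<-|pz].
  by rewrite mulr_ge0 ?expR_ge0// ltW.
rewrite -[X in X <= _]lnK ?posrE// -[p y in leRHS]lnK ?posrE// -expRD ler_expR.
have [|_ H] := @log_concave_between _ _ lc x y z _ px pz; first by rewrite yz ltW.
rewrite -(ler_pM2l yx) mulrDr /s mulNr mulrN mulrA [(y - x) * (_ / _)]mulrC divfK ?gt_eqF//.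
move: H; lra.
Qed.

(** If ln p increases from [x] to [y], its minimum on the block is at [x], so
    p x * (y - x) <= a; by [secant_left_tail] the slope of the secant is at most
    p x / a, hence the increase is at most 1. The other case is symmetric. *)
Lemma log_density_oscillation (a x y : R) : 0 < a -> x <= y ->
  a <= pr P `]-oo, x]%classic -> a <= pr P `[y, +oo[%classic ->
  pr P `[x, y]%classic <= a ->
  [/\ 0 < p x, 0 < p y & `|ln (p y) - ln (p x)| <= 1].
Proof.
move=> a0 xy ax ay axy.
have px : 0 < p x.
  apply: density_gt0; first exact: lt_le_trans ax.
  apply: (lt_le_trans a0); apply: (le_trans ay); apply: le_pr => //.
  by apply: subset_itvr; rewrite bnd_simp.
have py : 0 < p y.
  apply: density_gt0; last exact: lt_le_trans ay.
  apply: (lt_le_trans a0); apply: (le_trans ax); apply: le_pr => //.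
  by apply: subset_itvl; rewrite bnd_simp.
split=> //; move: (xy); rewrite le_eqVlt => /predU1P[<-|xy'].
  by rewrite subrr normr0.
have yx : 0 < y - x by rewrite subr_gt0.
have min_end (c : R) : 0 < c -> c <= p x -> c <= p y -> c * (y - x) <= a.
  move=> c0 cx cy; apply: le_trans axy; apply: (pr_itv_ge mp Pp) => //; first exact: ltW.
  move=> z /andP[xz zy].
  have [|pz] := @log_concave_between _ _ lc x z y _ px py; first by rewrite xz.
  move: cx cy; rewrite -ler_ln ?posrE// -[c <= p y]ler_ln ?posrE//.
  rewrite -[c <= p z]ler_ln ?posrE// => cx cy H.
  rewrite -(ler_pM2l yx); apply: le_trans H.
  have : (y - z) * ln c <= (y - z) * ln (p x) by rewrite ler_wpM2l ?subr_ge0.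
  have : (z - x) * ln c <= (z - x) * ln (p y) by rewrite ler_wpM2l ?subr_ge0.
  lra.
rewrite ler_norml; apply/andP; split.
- have [D|D] := leP 0 (ln (p y) - ln (p x)); first by lra.
  have xy_le : p y <= p x by rewrite -ler_ln ?posrE//; lra.
  have := secant_right_tail xy' px py; have := min_end _ py xy_le (lexx _).
  have : (ln (p x) - ln (p y)) * a <= (ln (p x) - ln (p y)) * pr P `[y, +oo[%classic.
    by rewrite ler_wpM2l//; lra.
  move=> h1 h2 h3; have : (ln (p x) - ln (p y)) * a <= 1 * a by lra.
  by rewrite ler_pM2r//; lra.
- have [D|D] := leP (ln (p y) - ln (p x)) 0; first by lra.
  have xy_le : p x <= p y by rewrite -ler_ln ?posrE//; lra.
  have := secant_left_tail xy' px py; have := min_end _ px (lexx _) xy_le.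
  have : (ln (p y) - ln (p x)) * a <= (ln (p y) - ln (p x)) * pr P `]-oo, x]%classic.
    by rewrite ler_wpM2l//; lra.
  move=> h1 h2 h3; have : (ln (p y) - ln (p x)) * a <= 1 * a by lra.
  by rewrite ler_pM2r//; lra.
Qed.

End log_concave_distribution.

(** * Piecewise log-affine approximation *)

Section piecewise_log_affine.
Context (R : realType).
Local Notation RR := (measurableTypeR R).
Local Notation mu := (@lebesgue_measure R).

(** The zero function is included for the two tails, where the density is not
    approximated. *)
Definition log_affine_on (g : R -> R) (I : set R) :=
  (forall x, I x -> g x = 0) \/
  exists al be, forall x, I x -> g x = expR (al + be * x).

(** Quantifying over the intervals that avoid [s], rather than over consecutive
    breakpoints, makes the notion insensitive to the order of [s] and to
    additional breakpoints. *)
Definition piecewise_log_affine (s : seq R) (g : R -> R) :=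
  forall I : set R, is_interval I -> (forall x, I x -> x \notin s) ->
    log_affine_on g I.

(** Approximants vanish outside [a, b[, so that approximants on adjacent intervals
    add up; [b] is required to be a breakpoint to separate them. *)
Definition log_affine_approx (p : RR -> R) (a b : R) (N : nat) (e : R) :=
  exists (s : seq R) (g : RR -> R),
    [/\ (size s <= N)%N, b \in s, piecewise_log_affine s g &
        forall x, ~~ (a <= x < b) -> g x = 0] /\
    [/\ measurable_fun setT g, (forall x, 0 <= g x) &
        (\int[mu]_(x in `[a, b[) (`|p x - g x|)%:E <= e%:E)%E].

Variable p : RR -> R.
Hypothesis mp : measurable_fun setT p.

Lemma log_affine_approx_refl a : log_affine_approx p a a 1 0.
Proof.
exists [:: a], (cst 0); split; split=> //.
- by rewrite mem_head.
- by move=> I _ _; left.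
- by rewrite set_itvco0 integral_set0.
Qed.

Lemma log_affine_approx_le a b N N' e e' : (N <= N')%N -> e <= e' ->
  log_affine_approx p a b N e -> log_affine_approx p a b N' e'.
Proof.
move=> NN ee [s [g [[sN bs pw g0] [mg gge0 ge]]]]; exists s, g; split; split=> //.
  exact: leq_trans NN.
by apply: le_trans ge _; rewrite lee_fin.
Qed.

Lemma measurable_abs_diff (g : RR -> R) (A : set RR) : measurable_fun setT g ->
  measurable_fun A (fun x => (`|p x - g x|)%:E).
Proof.
move=> mg; have : measurable_fun A (EFin \o (fun x : RR => `|p x - g x|)).
  apply/measurable_EFinP; apply: measurable_funTS.
  by apply: measurableT_comp => //; exact: measurable_funB.
by [].
Qed.

Lemma log_affine_approx_cat a b c N1 N2 e1 e2 : a <= b -> b <= c ->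
  log_affine_approx p a b N1 e1 -> log_affine_approx p b c N2 e2 ->
  log_affine_approx p a c (N1 + N2) (e1 + e2).
Proof.
move=> ab bc [s [g [[sN bs pwg gout] [mg g0 ge]]]].
move=> [t [h [[tN ct pwh hout] [mh h0 he]]]].
have gb x : b <= x -> g x = 0.
  by move=> bx; apply: gout; rewrite negb_and -!leNgt bx orbT.
have hb x : x < b -> h x = 0.
  by move=> bx; apply: hout; rewrite negb_and -!ltNge bx.
exists (s ++ t), (fun x => g x + h x); split; split.
- by rewrite size_cat leq_add.
- by rewrite mem_cat ct orbT.
- move=> I iI Ist.
  have Is x : I x -> x \notin s by move=> /Ist; rewrite mem_cat negb_or => /andP[].
  have It x : I x -> x \notin t by move=> /Ist; rewrite mem_cat negb_or => /andP[].
  have [[z Iz zb]|H] := pselect (exists2 z, I z & z < b).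
    have Ib x : I x -> x < b.
      move=> Ix; rewrite ltNge; apply/negP => bx.
      by have := Is _ (iI _ _ Iz Ix b (introT andP (conj (ltW zb) bx))); rewrite bs.
    case: (pwg I iI Is) => [gI|[al [be gI]]]; [left|right; exists al, be] => x Ix;
      by rewrite (hb _ (Ib _ Ix)) addr0 gI.
  have Ib x : I x -> b <= x by move=> Ix; rewrite leNgt; apply/negP => xb; apply: H; exists x.
  case: (pwh I iI It) => [gI|[al [be gI]]]; [left|right; exists al, be] => x Ix;
    by rewrite (gb _ (Ib _ Ix)) add0r gI.
- move=> x xac; rewrite gout ?hout ?addr0//.
    by apply: contra xac => /andP[/(le_trans ab) -> ->].
  by apply: contra xac => /andP[-> /lt_le_trans ->].
- exact: measurable_funD.
- by move=> x; rewrite addr_ge0.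
- have -> : `[a, c[%classic = `[a, b[%classic `|` `[b, c[%classic :> set RR.
    apply/seteqP; split=> x /=; rewrite !in_itv/=.
      by move=> /andP[ax xc]; have [bx|xb] := leP b x; [right; rewrite xc|left; rewrite ax].
    move=> [/andP[-> /lt_le_trans ->]//|/andP[bx ->]].
    by rewrite (le_trans ab bx).
  rewrite ge0_integral_setU//=; last 2 first.
  + by apply: measurable_abs_diff; exact: measurable_funD.
  + apply/disj_set2P/seteqP; split=> // x [] /=; rewrite !in_itv/=.
    by move=> /andP[_ xb] /andP[bx _]; move: xb; rewrite ltNge bx.
  rewrite EFinD; apply: leeD.
    rewrite (eq_integral (fun x => (`|p x - g x|)%:E))// => x.
    by rewrite inE /= in_itv/= => /andP[_ xb]; rewrite (hb _ xb) addr0.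
  rewrite (eq_integral (fun x => (`|p x - h x|)%:E))// => x.
  by rewrite inE /= in_itv/= => /andP[bx _]; rewrite (gb _ bx) add0r.
Qed.

Lemma log_affine_approx_piece (a b al be e : R) : a <= b -> 0 <= e ->
  (forall x, a <= x < b -> `|p x - expR (al + be * x)| <= e) ->
  log_affine_approx p a b 2 (e * (b - a)).
Proof.
move=> ab e0 pe; pose f (x : RR) : R := expR (al + be * x).
have mf : measurable_fun setT (f \_ `[a, b[%classic).
  apply/(measurable_restrictT _ _).1 => //.
  apply: measurable_funTS; apply: continuous_measurable_fun => z.
  have df (w : R) : derivable (fun z : R => expR (al + be * z)) w 1 by [].
  exact/differentiable_continuous/derivable1_diffP.
exists [:: a; b], (f \_ `[a, b[%classic); split; split=> //.
- by rewrite !inE eqxx orbT.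
- move=> I iI Iab; have [[z Iz /andP[az zb]]|H] := pselect (exists2 z, I z & a <= z < b).
    right; exists al, be => x Ix; rewrite patchE mem_set//= in_itv/=.
    apply/andP; split.
      rewrite leNgt; apply/negP => h.
      by have := Iab a (iI _ _ Ix Iz a (introT andP (conj (ltW h) az))); rewrite !inE eqxx.
    rewrite ltNge; apply/negP => h.
    by have := Iab b (iI _ _ Iz Ix b (introT andP (conj (ltW zb) h))); rewrite !inE eqxx orbT.
  left=> x Ix; rewrite patchE memNset//= in_itv/= => xab; by apply: H; exists x.
- by move=> x xab; rewrite patchE memNset//= in_itv/=; apply/negP.
- by move=> x; rewrite patchE; case: ifP => // _; exact: expR_ge0.
- apply: (@le_trans _ _ (\int[mu]_(x in `[a, b[) e%:E)%E).
    apply: ge0_le_integral => //.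
    + exact: measurable_abs_diff.
    + move=> x /= xab; rewrite lee_fin patchE mem_set//; apply: pe.
      by move: xab; rewrite in_itv.
  have -> : (\int[mu]_(x in `[a, b[) e%:E = e%:E * mu `[a, b[%classic)%E.
    exact: integral_cst.
  rewrite lebesgue_measure_itv/= lte_fin.
  have [ab'|ba] := ltP a b; first by rewrite -EFinB -EFinM.
  by rewrite mule0 lee_fin mulr_ge0// subr_ge0.
Qed.

End piecewise_log_affine.

Section log_affine_approximation.
Context (R : realType).
Local Notation RR := (measurableTypeR R).
Local Notation mu := (@lebesgue_measure R).
Variables (P : probability RR R) (p : RR -> R).
Hypotheses (mp : measurable_fun setT p) (p0 : forall x, 0 <= p x).
Hypothesis lc : log_concave p.
Hypothesis Pp : forall A, measurable A -> P A = (\int[mu]_(x in A) (p x)%:E)%E.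

(** [d] bounds the distance from ln p to its chord, and
    p (1 - exp (- d)) <= M d. *)
Lemma log_affine_approx_chord (u v M d : R) : u < v -> 0 < p u -> 0 < p v ->
  0 <= M -> 0 <= d -> (forall z, u <= z <= v -> p z <= M) ->
  (forall z, u <= z <= v ->
    (v - u) * ln (p z) <=
    (v - z) * ln (p u) + (z - u) * ln (p v) + (v - u) * d) ->
  log_affine_approx p u v 2 (M * d * (v - u)).
Proof.
move=> uv pu pv M0 d0 pM H; have vu : 0 < v - u by rewrite subr_gt0.
have vu0 : v - u != 0 by rewrite gt_eqF.
apply: (@log_affine_approx_piece _ _ mp u v
  ((v * ln (p u) - u * ln (p v)) / (v - u)) ((ln (p v) - ln (p u)) / (v - u))).
- exact: ltW.
- exact: mulr_ge0.
move=> z /andP[uz zv]; have uzv : u <= z <= v by rewrite uz ltW.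
have [pz] := log_concave_between lc uzv pu pv; have := H z uzv.
move=> Hu Hl; set chi := (X in expR X).
have chiE : (v - z) * ln (p u) + (z - u) * ln (p v) = (v - u) * chi.
  by rewrite /chi; field.
move: Hl Hu; rewrite chiE -mulrDr !ler_pM2l// => chi_le le_chi.
have e_le : expR chi <= p z by rewrite -[leRHS]lnK ?posrE// ler_expR.
rewrite ger0_norm ?subr_ge0//.
have eE : expR chi = p z * expR (chi - ln (p z)).
  by rewrite -{1}[p z]lnK ?posrE// -expRD; congr expR; ring.
apply: (@le_trans _ _ (p z * (ln (p z) - chi))).
  rewrite eE -{1}[p z]mulr1 -mulrBr ler_wpM2l//.
  by have := expR_ge1Dx (chi - ln (p z)); lra.
apply: (@le_trans _ _ (M * (ln (p z) - chi))).
  by rewrite ler_wpM2r ?subr_ge0// pM.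
by rewrite ler_wpM2l//; lra.
Qed.

(** With w = (y - x) / m and s i the increment of ln p over the i-th piece, the
    chord is off by at most s (i - 1) - s i, and by s 0 - s 1 on the first piece.
    The sum is at most twice the telescoping sum s 0 - s (m - 1), which the tail
    bounds for secants estimate by 5 p(x) w / a. As p <= 4 p(x) on the block and
    p(x) (y - x) <= 4 a, the L1 error is at most
    2 (4 p(x) w) (5 p(x) w / a) <= 640 a / m^2. *)
Lemma log_affine_approx_block (a x y : R) (m : nat) : (1 < m)%N -> 0 < a ->
  x < y -> a <= pr P `]-oo, x]%classic -> a <= pr P `[y, +oo[%classic ->
  pr P `[x, y]%classic <= a ->
  log_affine_approx p x y (2 * m) (640 * a / m%:R ^+ 2).
Proof.
move=> m1 a0 xy ax ay axy.
have m0 : 0 < m%:R :> R by rewrite ltr0n ltnW.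
have osc z : x <= z -> z <= y -> 0 < p z /\ `|ln (p z) - ln (p x)| <= 1.
  move=> xz zy; have [//|||_ -> ->//] := @log_density_oscillation _ _ _ mp p0 lc Pp a x z a0 xz.
  - apply: le_trans ay _; apply: le_pr => //; apply: subset_itvr; by rewrite bnd_simp.
  - apply: le_trans axy; apply: le_pr => //; apply: subset_itvl; by rewrite bnd_simp.
have [px _] := osc x (lexx _) (ltW xy); have [py _] := osc y (ltW xy) (lexx _).
set M := 4 * p x; have M0 : 0 < M by rewrite mulr_gt0.
have pM z : x <= z -> z <= y -> p z <= M.
  move=> xz zy; have [pz] := osc z xz zy; rewrite ler_norml => /andP[_ H].
  have : p z <= expR 1 * p x.
    by rewrite -[p z]lnK ?posrE// -[p x in leRHS]lnK ?posrE// -expRD ler_expR; lra.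
  by move=> /le_trans; apply; rewrite ler_wpM2r ?expR1_le4// ltW.
have p_ge z : x <= z -> z <= y -> p x / 4 <= p z.
  move=> xz zy; have [pz] := osc z xz zy; rewrite ler_norml => /andP[H _].
  rewrite ler_pdivrMr// mulrC; have : p x <= expR 1 * p z.
    by rewrite -[p x]lnK ?posrE// -[p z in leRHS]lnK ?posrE// -expRD ler_expR; lra.
  by move=> /le_trans; apply; rewrite ler_wpM2r ?expR1_le4// ltW.
set w := (y - x) / m%:R; have w0 : 0 < w by rewrite divr_gt0// subr_gt0.
have mw : m%:R * w = y - x by rewrite /w mulrC divfK// gt_eqF.
pose t i : R := x + i%:R * w.
have tS i : t i.+1 - t i = w by rewrite /t -natr1; ring.
have tx i : x <= t i by rewrite /t lerDl mulr_ge0// ltW.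
have ty i : (i <= m)%N -> t i <= y.
  by move=> im; rewrite /t -lerBrDl -mw ler_pM2r// ler_nat.
have ltt i : t i < t i.+1 by rewrite -subr_gt0 tS.
have pt i : (i <= m)%N -> 0 < p (t i).
  by move=> im; have [] := osc (t i) (tx i) (ty i im).
pose s i : R := ln (p (t i.+1)) - ln (p (t i)).
have s_decr i : (i.+1 < m)%N -> s i.+1 <= s i.
  move=> im; have [|_] := @log_concave_between _ _ lc (t i) (t i.+1) (t i.+2) _
    (pt _ (ltnW (ltnW im))) (pt _ im); first by rewrite !ltW.
  have -> : t i.+2 - t i = w + w by have := tS i; have := tS i.+1; lra.
  by rewrite !tS -mulrDr -mulr2n -mulr_natr -mulrA ler_pM2l// /s; lra.
have piece i d : (i < m)%N -> 0 <= d ->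
    (forall z, t i <= z <= t i.+1 -> w * ln (p z) <=
      (t i.+1 - z) * ln (p (t i)) + (z - t i) * ln (p (t i.+1)) + w * d) ->
    log_affine_approx p (t i) (t i.+1) 2 (M * d * w).
  move=> im d0 H; rewrite -(tS i).
  apply: log_affine_approx_chord => //; [exact/pt/ltnW|exact: pt|exact: ltW| |].
  - by move=> z /andP[tz zt]; apply: pM; [exact: le_trans tz|exact: le_trans zt (ty _ _)].
  - by rewrite tS.
(* the chord over the previous piece, extended to the right, dominates the log-density *)
have pieceS i : (i.+1 < m)%N ->
    log_affine_approx p (t i.+1) (t i.+2) 2 (M * (s i - s i.+1) * w).
  move=> im; apply: piece => //; first by rewrite subr_ge0 s_decr.
  move=> z /andP[tz zt].
  have pz : 0 < p z by have [] := osc z (le_trans (tx _) tz) (le_trans zt (ty _ im)).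
  have [|_] := @log_concave_between _ _ lc (t i) (t i.+1) z _ (pt _ (ltnW (ltnW im))) pz.
    by rewrite tz ltW.
  rewrite tS; have -> : z - t i = (z - t i.+1) + w by have := tS i; lra.
  have -> : t i.+2 - z = w - (z - t i.+1) by have := tS i.+1; lra.
  have rw : z - t i.+1 <= w by have := tS i.+1; lra.
  have := s_decr _ im; rewrite /s; set r := z - t i.+1 in rw *.
  move=> ss H; have : 0 <= (w - r) * (s i - s i.+1) by rewrite mulr_ge0 ?subr_ge0// s_decr.
  by rewrite /s; lra.
(* on the first piece, the chord over the second one extended to the left is used *)
have piece0 : log_affine_approx p (t 0%N) (t 1%N) 2 (M * (s 0%N - s 1%N) * w).
  apply: piece => //; [exact: ltnW|by rewrite subr_ge0 s_decr|].
  move=> z /andP[tz zt].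
  have pz : 0 < p z by have [] := osc z (le_trans (tx _) tz) (le_trans zt (ty _ (ltnW m1))).
  have [|_] := @log_concave_between _ _ lc z (t 1%N) (t 2%N) _ pz (pt _ m1).
    by rewrite zt ltW.
  rewrite tS; have -> : t 2%N - z = (t 1%N - z) + w by have := tS 1%N; lra.
  have -> : z - t 0%N = w - (t 1%N - z) by have := tS 0%N; lra.
  have rw : t 1%N - z <= w by have := tS 0%N; lra.
  set r := t 1%N - z in rw *.
  move=> H; have : 0 <= (w - r) * (s 0%N - s 1%N) by rewrite mulr_ge0 ?subr_ge0// s_decr.
  by move: H; rewrite /s; lra.
have pieces k : (k.+2 <= m)%N ->
    log_affine_approx p x (t k.+2) (2 * k.+2) (M * w * (2 * (s 0%N - s k.+1))).
  elim: k => [_|k IHk km].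
    have t0 : x = t 0%N by rewrite /t mul0r addr0.
    rewrite {1}t0; apply: log_affine_approx_le (log_affine_approx_cat mp _ _ piece0 (pieceS _ m1)).
    - by [].
    - by rewrite le_eqVlt; apply/orP; left; apply/eqP; ring.
    - exact: ltW.
    - exact: ltW.
  apply: log_affine_approx_le (log_affine_approx_cat mp _ _ (IHk (ltnW km)) (pieceS _ km)).
  - by rewrite [leqRHS]mulnS addnC.
  - have := s_decr _ km => ss.
    have : 0 <= M * w * (s k.+1 - s k.+2).
      by rewrite mulr_ge0 ?subr_ge0//; apply: mulr_ge0; exact: ltW.
    lra.
  - exact: tx.
  - exact: ltW.
have mE : m = (m - 2).+2 by rewrite -{1}(subnK m1) addn2.
have tm : t m = y by rewrite /t mw addrC subrK.
have := pieces (m - 2)%N; rewrite -mE tm => /(_ (leqnn _)).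
apply: log_affine_approx_le => //.
have m2 : (m - 2).+1 = m.-1 by rewrite {2}mE.
rewrite m2; have m1m : m.-1.+1 = m by rewrite prednK// ltnW.
have pxw : p x / 4 * (y - x) <= a.
  apply: le_trans axy; apply: (pr_itv_ge mp Pp); [exact: ltW|by rewrite divr_ge0// ltW|].
  by move=> z /andP[]; exact: p_ge.
have s0 : s 0%N * a <= p x * w.
  have t0 : t 0%N = x by rewrite /t mul0r addr0.
  have := secant_left_tail mp p0 lc Pp (ltt 0%N) (pt _ (ltnW (ltnW m1))) (pt _ (ltnW m1)).
  rewrite -/(s 0%N) tS t0 => H; have [s00|s00] := leP 0 (s 0%N).
    by apply: le_trans H; rewrite ler_wpM2l.
  apply: (@le_trans _ _ 0); first by rewrite ltW// nmulr_rlt0.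
  by rewrite mulr_ge0// ltW.
have sm : - s m.-1 * a <= M * w.
  have := secant_right_tail mp p0 lc Pp (ltt m.-1) (pt _ (leq_pred _)) _.
  have := tS m.-1; rewrite m1m tm => -> /(_ py).
  have -> : ln (p (t m.-1)) - ln (p y) = - s m.-1 by rewrite /s m1m tm opprB.
  move=> H; have [s00|s00] := leP 0 (- s m.-1).
    apply: (@le_trans _ _ (p y * w)).
      by apply: le_trans H; rewrite ler_wpM2l.
    by apply: ler_wpM2r; [exact: ltW|apply: pM => //; exact: ltW].
  apply: (@le_trans _ _ 0); first by rewrite ltW// nmulr_rlt0.
  by rewrite mulr_ge0// ltW.
rewrite -(ler_pM2r a0); set q := p x * w in s0.
have q0 : 0 < q by rewrite mulr_gt0.
have qm : q * m%:R <= 4 * a by rewrite /q -mulrA [w * _]mulrC mw; lra.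
have Mw : M * w = 4 * q by rewrite /M /q mulrA.
rewrite Mw in sm *; apply: (@le_trans _ _ (40 * q ^+ 2)).
  have : (s 0%N - s m.-1) * a <= 5 * q by lra.
  move=> /(ler_wpM2l (ltW q0)); lra.
have -> : 640 * a / m%:R ^+ 2 * a = 40 * (4 * a / m%:R) ^+ 2 by field; rewrite gt_eqF.
have qa : q <= 4 * a / m%:R by rewrite ler_pdivlMr.
by rewrite ler_wpM2l// lerXn2r// nnegrE; [exact: ltW|exact: le_trans (ltW q0) qa].
Qed.

End log_affine_approximation.

Section dyadic.
Context (R : realType).
Local Notation RR := (measurableTypeR R).
Local Notation mu := (@lebesgue_measure R).
Variables (P : probability RR R) (p : RR -> R).
Hypotheses (mp : measurable_fun setT p) (p0 : forall x, 0 <= p x).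
Hypothesis lc : log_concave p.
Hypothesis Pp : forall A, measurable A -> P A = (\int[mu]_(x in A) (p x)%:E)%E.

Let F (x : R) : R := pr P `]-oo, x]%classic.

Lemma pr_itvNyo (x : R) : pr P `]-oo, x[%classic = F x.
Proof.
apply/eqP; rewrite eq_le; apply/andP; split.
  by apply: le_pr => //; apply: subset_itvl; rewrite bnd_simp.
rewrite /F -(@setUitv1 _ _ -oo%O x true)//.
by rewrite (le_trans (pr_setU_le _ _ _))// (pr_set1 mp p0 Pp) addr0.
Qed.

Lemma pr_itvcy (x : R) : pr P `[x, +oo[%classic = 1 - F x.
Proof.
rewrite -pr_itvNyo -pr_setC//; congr (pr P _).
by rewrite setCitvl.
Qed.

Lemma pr_itvcc (x y : R) : x <= y -> pr P `[x, y]%classic = F y - F x.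
Proof.
move=> xy; rewrite -(pr_itvNyo x); apply/eqP; rewrite eq_sym subr_eq addrC; apply/eqP.
rewrite -pr_setU//.
  congr (pr P _); apply/seteqP; split=> z /=; rewrite !in_itv/=.
    by move=> zy; have [xz|zx] := leP x z; [right; rewrite zy|left].
  by move=> [zx|/andP[]//]; apply: le_trans xy; exact: ltW.
apply/disj_set2P/seteqP; split=> // z [] /=; rewrite !in_itv/= => zx /andP[xz _].
by move: zx; rewrite ltNge xz.
Qed.

Lemma cdf_lt (x y : R) : F x < F y -> x < y.
Proof.
move=> Fxy; rewrite ltNge; apply/negP => yx; move: Fxy; rewrite ltNge; case/negP.
by apply: le_pr => //; apply: subset_itvl; rewrite bnd_simp.
Qed.

Lemma log_affine_approx_quantiles (m : nat) (a x y : R) : (1 < m)%N ->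
  0 < a -> a <= 1 -> a <= F x -> F y = F x + a -> F y <= 1 - a ->
  log_affine_approx p x y (2 * m) (640 / m%:R ^+ 2).
Proof.
move=> m1 a0 a1 ax Fy ay; have xy : x < y by apply: cdf_lt; rewrite Fy ltrDl.
have m0 : 0 < m%:R :> R by rewrite ltr0n ltnW.
apply: log_affine_approx_le (log_affine_approx_block mp p0 lc Pp m1 a0 xy ax _ _).
- by [].
- by rewrite ler_wpM2r ?invr_ge0 ?sqr_ge0//; lra.
- by rewrite pr_itvcy; lra.
- by rewrite pr_itvcc; [rewrite Fy; lra|exact: ltW].
Qed.

Definition l1_log_affine_approx (N : nat) (e : R) :=
  exists (s : seq R) (g : RR -> R),
    [/\ (size s <= N)%N, piecewise_log_affine s g, measurable_fun setT g,
        (forall x, 0 <= g x) &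
        (\int[mu]_x (`|p x - g x|)%:E <= e%:E)%E].

(** Dyadic blocks from the median outwards: the block between the quantiles
    2^(-j-2) and 2^(-j-1) has mass a = 2^(-j-2), with mass at least a on either
    side. Bounding a by 1 in every block costs only a logarithmic factor. *)
Lemma log_concave_approx (m J : nat) : (1 < m)%N ->
  l1_log_affine_approx (2 + 4 * m * J) (1280 * J%:R / m%:R ^+ 2 + 1 / 2 ^+ J).
Proof.
move=> m1.
have p2 k : (2 ^+ k : R) != 0 by rewrite expf_neq0.
have half j : 0 < 1 / 2 ^+ j.+1 :> R by rewrite divr_gt0// exprn_gt0.
have half_le j : 1 / 2 ^+ j.+1 <= 1 / 2 :> R.
  rewrite ler_pM2l// lef_pV2 ?posrE ?exprn_gt0// exprS ler_peMr// exprn_ege1//.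
  by rewrite ler1n.
have halfS j : 1 / 2 ^+ j.+1 = 1 / 2 ^+ j.+2 + 1 / 2 ^+ j.+2 :> R.
  by rewrite [2 ^+ j.+2]exprS; field; exact: p2.
have /choice[q qP] : forall u : R, exists x, 0 < u < 1 -> F x = u.
  move=> u; have [u01|nu] := boolP (0 < u < 1); last by exists 0.
  by have [x xu] := quantile_eq mp p0 Pp u01; exists x.
have ql j : F (q (1 / 2 ^+ j.+1)) = 1 / 2 ^+ j.+1.
  by apply: qP; have := half j; have := half_le j; lra.
have qr j : F (q (1 - 1 / 2 ^+ j.+1)) = 1 - 1 / 2 ^+ j.+1.
  by apply: qP; have := half j; have := half_le j; lra.
have mid : 1 - 1 / 2 ^+ 1 = 1 / 2 ^+ 1 :> R by rewrite expr1; lra.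
pose x0 := q (1 / 2 ^+ 1).
pose c : R := 640 / m%:R ^+ 2.
have stepE (j : nat) : c + j%:R * c = j.+1%:R * c by rewrite -natr1; ring.
have left_part j : q (1 / 2 ^+ j.+1) <= x0 /\
    log_affine_approx p (q (1 / 2 ^+ j.+1)) x0 (1 + 2 * m * j) (j%:R * c).
  elim: j => [|j [qx IH]]; first by rewrite muln0 mul0r; split=> //; exact: log_affine_approx_refl.
  have qq : q (1 / 2 ^+ j.+2) <= q (1 / 2 ^+ j.+1).
    by apply/ltW/cdf_lt; rewrite !ql (halfS j) ltrDl.
  split; first exact: le_trans qx.
  have B : log_affine_approx p (q (1 / 2 ^+ j.+2)) (q (1 / 2 ^+ j.+1)) (2 * m) c.
    apply: (@log_affine_approx_quantiles m (1 / 2 ^+ j.+2)) => //.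
    - by have := half_le j.+1; lra.
    - by rewrite ql.
    - by rewrite !ql halfS.
    - by rewrite ql; have := half_le j.+1; have := half_le j; lra.
  rewrite -stepE; apply: log_affine_approx_le (log_affine_approx_cat mp qq qx B IH) => //.
  lia.
have right_part j : x0 <= q (1 - 1 / 2 ^+ j.+1) /\
    log_affine_approx p x0 (q (1 - 1 / 2 ^+ j.+1)) (1 + 2 * m * j) (j%:R * c).
  elim: j => [|j [qx IH]].
    by rewrite mid muln0 mul0r; split=> //; exact: log_affine_approx_refl.
  have qq : q (1 - 1 / 2 ^+ j.+1) <= q (1 - 1 / 2 ^+ j.+2).
    by apply/ltW/cdf_lt; rewrite !qr (halfS j); have := half j.+1; lra.
  split; first exact: le_trans qq.
  have B : log_affine_approx p (q (1 - 1 / 2 ^+ j.+1)) (q (1 - 1 / 2 ^+ j.+2)) (2 * m) c.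
    apply: (@log_affine_approx_quantiles m (1 / 2 ^+ j.+2)) => //.
    - by have := half_le j.+1; lra.
    - by rewrite qr; have := half_le j.+1; have := half_le j; lra.
    - by rewrite !qr; have := halfS j; lra.
    - by rewrite qr.
  rewrite -stepE [c + _]addrC; apply: log_affine_approx_le (log_affine_approx_cat mp qx qq IH B) => //.
  lia.
have [lx L] := left_part J; have [xr Rt] := right_part J.
have [s [g [[sN _ pw gout] [mg g0 ge]]]] := log_affine_approx_cat mp lx xr L Rt.
set a := q (1 / 2 ^+ J.+1) in lx ge gout L; set b := q (1 - 1 / 2 ^+ J.+1) in xr ge gout Rt.
have ab : a <= b by exact: le_trans xr.
exists s, g; split=> //; first by apply: leq_trans sN _; lia.
have TE : [set: RR] = `]-oo, a[%classic `|` (`[a, b[%classic `|` `[b, +oo[%classic).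
  apply/seteqP; split=> // x _ /=; rewrite !in_itv/= andbT.
  by have [ax|xa] := leP a x; [right; have [bx|xb] := leP b x; [right|left]|left].
have mout (A : set RR) : measurable A -> (forall x, A x -> ~~ (a <= x < b)) ->
    (\int[mu]_(x in A) (`|p x - g x|)%:E = (pr P A)%:E)%E.
  move=> mA Aout; rewrite -prE// Pp//; apply: eq_integral => x; rewrite inE => Ax.
  by rewrite gout ?Aout// subr0 ger0_norm.
have mabs A := @measurable_abs_diff _ _ mp g A mg.
rewrite TE ge0_integral_setU//=; last 2 first.
- exact: measurableU.
- apply/disj_set2P/seteqP; split=> // x [] /=; rewrite !in_itv/= andbT => xa.
  by case=> [/andP[ax _]|bx]; move: xa; rewrite ltNge ?ax// (le_trans ab).
rewrite ge0_integral_setU//=; last first.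
  apply/disj_set2P/seteqP; split=> // x [] /=; rewrite !in_itv/= andbT => /andP[_ xb] bx.
  by move: xb; rewrite ltNge bx.
rewrite mout//; last by move=> x /=; rewrite in_itv/= negb_and -ltNge => ->.
rewrite [X in (_ + (_ + X))%E]mout//; last first.
  by move=> x /=; rewrite in_itv/= andbT negb_and -!leNgt => ->; rewrite orbT.
rewrite pr_itvNyo ql pr_itvcy qr.
apply: (@le_trans _ _ ((1 / 2 ^+ J.+1)%:E +
  ((J%:R * c + J%:R * c)%:E + (1 - (1 - 1 / 2 ^+ J.+1))%:E))%E).
  by apply: leeD => //; apply: leeD.
rewrite -!EFinD lee_fin /c exprS.
rewrite le_eqVlt; apply/orP; left; apply/eqP; field.
by rewrite p2 pnatr_eq0 -lt0n ltnW.
Qed.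

End dyadic.

(** * Sign sets of piecewise log-affine functions *)

Section sign_set.
Context (R : realType).
Local Notation RR := (measurableTypeR R).

(** The endpoint where the affine function vanishes is clamped to [A, B], so that
    degenerate cases give an empty interval inside [A, B]. *)
Lemma affine_pos_set (A B : \bar R) (al be : R) : (A <= B)%E ->
  exists a b, [/\ (A <= a)%E, (a <= b)%E, (b <= B)%E &
    forall x : R, (a < x%:E < b)%E = (A < x%:E < B)%E && (0 < al + be * x)].
Proof.
move=> AB; have [be0|be0|->] := ltgtP be 0.
- exists A, (Order.max (Order.min B (- (al / be))%:E) A); split=> //.
  + by rewrite le_max lexx orbT.
  + by rewrite ge_max AB andbT ge_min lexx.
  + move=> x; have -> : (0 < al + be * x) = (x%:E < (- (al / be))%:E)%E.
      rewrite lte_fin -[in LHS](divfK (ltr0_neq0 be0) al) [_ * be]mulrC -mulrDr nmulr_rgt0//.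
      by rewrite addrC -ltrBrDr sub0r.
    rewrite lt_max lt_min; case: (boolP (A < x%:E)%E) => //= Ax.
    by rewrite [(x%:E < A)%E]ltNge (ltW Ax) orbF.
- exists (Order.min (Order.max A (- (al / be))%:E) B), B; split=> //.
  + by rewrite le_min AB andbT le_max lexx.
  + by rewrite ge_min lexx orbT.
  + move=> x; have -> : (0 < al + be * x) = ((- (al / be))%:E < x%:E)%E.
      rewrite lte_fin -[in LHS](divfK (lt0r_neq0 be0) al) [_ * be]mulrC -mulrDr pmulr_rgt0//.
      by rewrite -ltrBlDl sub0r.
    rewrite gt_min gt_max; case: (boolP (x%:E < B)%E) => xB; last by rewrite !andbF.
    by rewrite !andbT [(B < x%:E)%E]ltNge (ltW xB) orbF.
- have [al0|al0] := ltP 0 al.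
    by exists A, B; split=> // x; rewrite mul0r addr0 al0 andbT.
  exists A, A; split=> // x; rewrite mul0r addr0 [0 < al]ltNge al0 andbF.
  by apply/negbTE/negP => /andP[/lt_trans h /h]; rewrite ltxx.
Qed.

Lemma log_affine_sign_set (g h : R -> R) (A B : \bar R) : (A <= B)%E ->
  let I := [set x : R | (A < x%:E < B)%E] in
  log_affine_on g I -> log_affine_on h I ->
  exists a b, [/\ (A <= a)%E, (a <= b)%E, (b <= B)%E &
    forall x : R, (a < x%:E < b)%E = (A < x%:E < B)%E && (g x < h x)].
Proof.
move=> AB I gI hI.
have empty : (forall x, I x -> ~~ (g x < h x)) ->
    exists a b, [/\ (A <= a)%E, (a <= b)%E, (b <= B)%E &
      forall x : R, (a < x%:E < b)%E = (A < x%:E < B)%E && (g x < h x)].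
  move=> H; exists A, A; split=> // x.
  have -> : (A < x%:E < A)%E = false.
    by apply/negbTE/negP => /andP[/lt_trans k /k]; rewrite ltxx.
  by apply/esym/negbTE/negP => /andP[/H/negbTE ->].
case: hI => [h0|[al' [be' hE]]].
  apply: empty => x Ix; rewrite h0// -leNgt.
  by case: gI => [->//|[al [be ->]]//]; exact: expR_ge0.
case: gI => [g0|[al [be gE]]].
  exists A, B; split=> // x; have [xI|//] := boolP (A < x%:E < B)%E.
  by rewrite g0// hE// expR_gt0.
have [a [b [Aa ab bB abE]]] := affine_pos_set (al' - al) (be' - be) AB.
exists a, b; split=> // x; rewrite abE; have [xI|//] := boolP (A < x%:E < B)%E.
rewrite gE// hE// ltr_expR -(subr_gt0 (al + be * x)).
by have -> : al' + be' * x - (al + be * x) = al' - al + (be' - be) * x by ring.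
Qed.

(** Between consecutive breakpoints both functions are log-affine or zero, so
    {g < h} is an interval there; fewer than [K] breakpoints cut the line into
    at most [K] cells. *)
Lemma sign_set_interval_union (K : nat) (s t : seq R) (g h : R -> R) :
  (size s + size t < K)%N ->
  piecewise_log_affine s g -> piecewise_log_affine t h ->
  exists2 S, interval_unions K S &
    forall x, S x <-> x \notin s ++ t /\ g x < h x.
Proof.
move=> sK pwg pwh; set u := sort <=%R (s ++ t).
have su : (size u < K)%N by rewrite size_sort size_cat.
have memu x : (x \in u) = (x \in s ++ t) by rewrite mem_sort.
have uS : sorted <=%R u by rewrite sort_le_sorted.
pose T j : \bar R := if j == 0%N then -oo%E else
  if (j <= size u)%N then (u`_j.-1)%:E else +oo%E.
have T_mono i j : (i <= j)%N -> (T i <= T j)%E.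
  rewrite /T; case: i => [|i]; first by rewrite leNye.
  case: j => [//|j] /= ij; have [ju|ju] := leqP j.+1 (size u); last by rewrite leey.
  rewrite (leq_trans ij ju) lee_fin.
  by apply: (sorted_leq_nth le_trans le_refl 0 uS); rewrite ?inE//; exact: leq_trans ju.
have cell_free j x : (T j < x%:E < T j.+1)%E -> x \notin u.
  move=> /andP[jx xj]; apply/negP => xu.
  have Tx : T (index x u).+1 = x%:E by rewrite /T/= index_mem xu nth_index.
  have [kj|jk] := leqP (index x u).+1 j.
    by have := T_mono _ _ kj; rewrite Tx leNgt jx.
  by have := T_mono _ _ jk; rewrite Tx leNgt xj.
have /choice[ab abP] : forall j : 'I_K, exists ab : \bar R * \bar R,
    [/\ (T j <= ab.1)%E, (ab.1 <= ab.2)%E, (ab.2 <= T j.+1)%E &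
      forall x : R, (ab.1 < x%:E < ab.2)%E = (T j < x%:E < T j.+1)%E && (g x < h x)].
  move=> j; have iI : is_interval [set x : R | (T j < x%:E < T j.+1)%E].
    move=> x y /= /andP[jx _] /andP[_ yj] z /andP[xz zy].
    by rewrite (lt_le_trans jx) ?lee_fin//= (le_lt_trans _ yj) ?lee_fin.
  have [||a [b abP]] := @log_affine_sign_set g h (T j) (T j.+1) (T_mono _ _ (leqnSn j)).
  - by apply: pwg => // x /cell_free; rewrite memu mem_cat negb_or => /andP[].
  - by apply: pwh => // x /cell_free; rewrite memu mem_cat negb_or => /andP[].
  by exists (a, b).
exists (\bigcup_j [set x : R | ((ab j).1 < x%:E < (ab j).2)%E]).
  exists (fun j => (ab j).1), (fun j => (ab j).2); split=> //.
    by move=> j; have [] := abP j.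
  move=> i j ji; have [_ _ + _] := abP i; have [+ _ _ _] := abP j.
  by rewrite ji => Tj /le_trans; apply.
move=> x; split=> [[j _ /=]|[xs gh]].
  have [_ _ _ ->] := abP j => /andP[/cell_free + ->].
  by rewrite memu.
have K0 : (0 < K)%N by apply: leq_ltn_trans su.
have H0 : (T (Ordinal K0) < x%:E)%E by rewrite /T/= ltNyr.
case: (@arg_maxnP _ (Ordinal K0) (fun k : 'I_K => T k < x%:E)%E val H0) => j jP jmax.
exists j => //=; have [_ _ _ ->] := abP j; rewrite gh jP andbT/=.
have xT : (x%:E <= T j.+1)%E.
  have [jK|jK] := ltnP j.+1 K.
    rewrite leNgt; apply/negP => Tx.
    by have := jmax (Ordinal jK) Tx; rewrite /= ltnn.
  by rewrite /T/= ifF ?leey//; apply/negbTE; rewrite -ltnNge (leq_trans su).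
rewrite lt_neqAle xT andbT; apply/eqP; rewrite /T/=; case: ifP => // ju [xE].
by move: xs; rewrite -memu xE mem_nth.
Qed.

End sign_set.

Section transfer.
Context (R : realType).
Local Notation RR := (measurableTypeR R).
Local Notation mu := (@lebesgue_measure R).

Section one_density.
Variables (P : probability RR R) (p : RR -> R).
Hypotheses (mp : measurable_fun setT p) (p0 : forall x, 0 <= p x).
Hypothesis Pp : forall A, measurable A -> P A = (\int[mu]_(x in A) (p x)%:E)%E.

Lemma set_seq_cons (x : R) (s : seq R) : [set` x :: s] = [set x] `|` [set` s].
Proof.
apply/seteqP; split=> y /=; rewrite inE; first by case/orP => [/eqP|]; [left|right].
by case=> [->|->]; rewrite ?eqxx ?orbT.
Qed.

Lemma measurable_seq (s : seq R) : measurable ([set` s] : set RR).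
Proof.
elim: s => [|x s IH]; last by rewrite set_seq_cons; exact: measurableU.
by rewrite (_ : [set` _] = set0)//; apply/seteqP; split.
Qed.

Lemma pr_seq (s : seq R) : pr P [set` s] = 0.
Proof.
apply/eqP; rewrite eq_le pr_ge0 andbT; elim: s => [|x s IH].
  by rewrite (_ : [set` _] = set0) ?/pr ?measure0//; apply/seteqP; split.
rewrite set_seq_cons; apply: (le_trans (pr_setU_le _ _ _)) => //.
  exact: measurable_seq.
by rewrite (pr_set1 mp p0 Pp) add0r.
Qed.

Lemma integral_density_indic (A : set RR) : measurable A ->
  (\int[mu]_x (p x * \1_A x)%:E)%E = (pr P A)%:E.
Proof.
move=> mA; rewrite -prE// Pp// [RHS]integral_mkcond; apply: eq_integral => x _.
by rewrite patchE indicE; case: ifP => xA; rewrite ?mulr1 ?mulr0.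
Qed.

Lemma measurable_density_indic (A : set RR) : measurable A ->
  measurable_fun setT (fun x => (p x * \1_A x)%:E).
Proof.
move=> mA; have : measurable_fun setT (EFin \o (fun x : RR => p x * \1_A x)).
  by apply/measurable_EFinP; apply: measurable_funM => //; exact: measurable_indic.
by [].
Qed.

End one_density.

Variables (P Q : probability RR R) (p q : RR -> R).
Hypotheses (mp : measurable_fun setT p) (p0 : forall x, 0 <= p x).
Hypothesis Pp : forall A, measurable A -> P A = (\int[mu]_(x in A) (p x)%:E)%E.
Hypotheses (mq : measurable_fun setT q) (q0 : forall x, 0 <= q x).
Hypothesis Qq : forall A, measurable A -> Q A = (\int[mu]_(x in A) (q x)%:E)%E.

(** Off [N], a point of [A] outside [S] has h <= g, hence
    q - p <= |p - g| + |q - h|; likewise for p - q at a point of [S] outside [A]. *)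
Lemma sign_set_near_optimal (g h : RR -> R) (A S N : set RR) (e1 e2 : R) :
  measurable_fun setT g -> measurable_fun setT h ->
  (\int[mu]_x (`|p x - g x|)%:E <= e1%:E)%E ->
  (\int[mu]_x (`|q x - h x|)%:E <= e2%:E)%E ->
  measurable A -> measurable S -> measurable N -> pr Q N = 0 ->
  (forall x, S x <-> ~ N x /\ g x < h x) ->
  pr Q A - pr P A <= pr Q S - pr P S + (e1 + e2).
Proof.
move=> mg mh ge he mA mS mN QN SE.
have mD : measurable (A `\` N) by exact: measurableD.
have QA : pr Q A <= pr Q (A `\` N).
  apply: (@le_trans _ _ (pr Q ((A `\` N) `|` N))).
    apply: le_pr => //; first exact: measurableU.
    by move=> x Ax; have [Nx|Nx] := pselect (N x); [right|left].
  by apply: (le_trans (pr_setU_le _ _ _)) => //; rewrite QN addr0.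
have PA : pr P (A `\` N) <= pr P A by apply: le_pr => // x [].
suff : pr Q (A `\` N) + pr P S <= pr Q S + pr P (A `\` N) + (e1 + e2) by lra.
set B := A `\` N in mD QA PA *.
pose f1 x := ((q x * \1_B x)%:E + (p x * \1_S x)%:E)%E.
pose f2 x := (((q x * \1_S x)%:E + (p x * \1_B x)%:E) +
  ((`|p x - g x|)%:E + (`|q x - h x|)%:E))%E.
have mqi := measurable_density_indic mq; have mpi := measurable_density_indic mp.
have qi0 (C : set RR) x : (0 <= (q x * \1_C x)%:E)%E by rewrite lee_fin mulr_ge0.
have pi0 (C : set RR) x : (0 <= (p x * \1_C x)%:E)%E by rewrite lee_fin mulr_ge0.
have mga := @measurable_abs_diff _ _ mp g setT mg.
have mha := @measurable_abs_diff _ _ mq h setT mh.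
have n0 (u : R) : (0 <= `|u|%:E)%E by rewrite lee_fin.
have I1 : (\int[mu]_x f1 x = (pr Q B + pr P S)%:E)%E.
  rewrite /f1 ge0_integralD//; try exact: mqi; try exact: mpi.
  by rewrite !(integral_density_indic Qq, integral_density_indic Pp).
have I2 : (\int[mu]_x f2 x <= (pr Q S + pr P B + (e1 + e2))%:E)%E.
  rewrite /f2 ge0_integralD//; first last.
  - exact: emeasurable_funD.
  - by move=> x _; rewrite adde_ge0.
  - by apply: emeasurable_funD; [exact: mqi|exact: mpi].
  - by move=> x _; rewrite adde_ge0.
  rewrite ge0_integralD//; try exact: mqi; try exact: mpi.
  rewrite ge0_integralD//.
  rewrite !(integral_density_indic Qq, integral_density_indic Pp)//.
  by rewrite !EFinD leeD// leeD.
rewrite -lee_fin -I1; apply: le_trans I2; apply: ge0_le_integral => //.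
- by move=> x _; rewrite adde_ge0.
- by apply: emeasurable_funD; [exact: mqi|exact: mpi].
- apply: emeasurable_funD; last exact: emeasurable_funD.
  by apply: emeasurable_funD; [exact: mqi|exact: mpi].
move=> x _; rewrite /f1 /f2 -!EFinD lee_fin !indicE.
have := ler_norm (p x - g x); have := ler_norm (- (p x - g x)); rewrite normrN.
have := ler_norm (q x - h x); have := ler_norm (- (q x - h x)); rewrite normrN.
have [Bx|Bx] := pselect (B x); [rewrite (mem_set Bx)|rewrite (memNset Bx)].
  have [Sx|Sx] := pselect (S x); [rewrite (mem_set Sx)|rewrite (memNset Sx)].
    by rewrite !mulr1; lra.
  rewrite !mulr1 !mulr0; suff : h x <= g x by lra.
  by rewrite leNgt; apply/negP => gh; apply: Sx; apply/SE; split=> //; case: Bx.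
have [Sx|Sx] := pselect (S x); [rewrite (mem_set Sx)|rewrite (memNset Sx)].
  by have /SE[_ gh] := Sx; rewrite !mulr1 !mulr0; lra.
by rewrite !mulr0; lra.
Qed.

End transfer.

(** * The power of the test *)

Section type_two_error.
Context (R : realType).
Local Notation RR := (measurableTypeR R).

Lemma h_plus_le (tau t : R) : 0 < tau -> tau <= 1 -> 0 <= t <= 1 ->
  h_plus tau t <= t + 2 * Num.sqrt tau.
Proof.
move=> tau0 tau1 /andP[t0 t1]; rewrite /h_plus ge_min; apply/orP; left.
have V1 : V t <= 1 by rewrite /V ge_min t1.
have : Num.sqrt (tau * V t) <= Num.sqrt tau by rewrite ler_wsqrtr// ler_piMr// ltW.
suff : tau <= Num.sqrt tau by lra.
have : Num.sqrt tau ^+ 2 = tau by rewrite sqr_sqrtr// ltW.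
have : Num.sqrt tau <= 1 by rewrite -sqrtr1 ler_wsqrtr.
have := sqrtr_ge0 tau; nra.
Qed.

(** The set [S] is fixed, so only the two upper tails for [S] and its complement
    are needed, with all square roots bounded by sqrt tau. *)
Lemma type_two_error (delta : R) K n (P Q : probability RR R) (eps1 : R) (S : set R) :
  0 < delta < 1 -> (0 < n)%N ->
  tau (@interval_unions R K) n delta <= 1 / 2 -> interval_unions K S ->
  pr P S + pr Q (~` S) + 6 * Num.sqrt (tau (@interval_unions R K) n delta) < 1 - eps1 ->
  ('E_(iid_law P n \x iid_law Q n)[fun z =>
     (1 - psi (@interval_unions R K) (g_tv eps1) n delta z)%R] <= delta%:E)%E.
Proof.
move=> hdelta n0 tau12 SS; set t := tau _ _ _ in tau12 *; move=> gap.
have t0 : 0 < t by exact: tau_gt0.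
have t34 : 0 < 3 / 4 * t by lra.
have mS : measurable (S : set RR) by exact: measurable_interval_unions SS.
have mSc : measurable (~` S : set RR) by exact: measurableC.
have mB1 : measurable (@upper_dev _ _ _ P n (3 / 4 * t) S) by exact: measurable_upper_dev.
have mB2 : measurable (@upper_dev _ _ _ Q n (3 / 4 * t) (~` S)) by exact: measurable_upper_dev.
have dev (P' : probability RR R) (A : set RR) (x : n.-tuple RR) :
    ~ upper_dev P' (3 / 4 * t) A x ->
    h_plus t (freq A x) <= pr P' A + 3 * Num.sqrt t.
  move=> /negP; rewrite -leNgt => H.
  have := @h_plus_le t (freq A x) t0; rewrite freq_ge0 freq_le1 => /(_ _ isT) h.
  have : Num.sqrt (3 / 4 * t * freq A x) <= Num.sqrt t.
    by rewrite ler_wsqrtr//; have := freq_ge0 R A x; have := freq_le1 R A x; nra.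
  by have := h _; lra.
have := @expectation_le_pr_either _ _ _ _ _ (iid_law P n) (iid_law Q n)
  (fun z => 1 - psi (@interval_unions R K) (g_tv eps1) n delta z) _ _ mB1 mB2.
move=> /(_ _ _)/le_trans; apply.
- by move=> z; rewrite /psi indicE; case: (_ \in _); rewrite ?subrr ?subr0 ?lexx ler01.
- move=> z z1 z2; rewrite /psi indicE mem_set ?subrr//=; exists S => //.
  have := dev _ _ _ z1; have := dev _ _ _ z2.
  rewrite -/t /g_tv /empirical /freq /hits => HQ HP.
  by rewrite lt_max; apply/orP; left; lra.
have E : expR (n%:R * - (3 / 4 * t / 2)) <= delta / 2.
  apply: le_trans (union_bound_le hdelta K n0); rewrite -/t.
  rewrite ler_peMl ?expR_ge0// (ler1n R) muln_gt0/= card_ffun card_prod !card_ord.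
  by rewrite expn_gt0 muln_gt0 n0.
have := upper_tail P n0 t34 mS; have := upper_tail Q n0 t34 mSc.
by rewrite lee_fin; lra.
Qed.

End type_two_error.

Lemma pieces_per_scale (K J : nat) : (0 < J)%N -> (32 * J <= K)%N ->
  exists m : nat, [/\ (1 < m)%N, (2 * (2 + 4 * m * J) < K)%N &
    (K <= 32 * (m * J))%N].
Proof.
move=> J0 JK; exists (K %/ (16 * J))%N; set m := (K %/ (16 * J))%N.
have m2 : (1 < m)%N by rewrite leq_divRL ?muln_gt0// mulnA.
have mK : (m * (16 * J) <= K)%N by exact: leq_trunc_div.
have Km : (K < m.+1 * (16 * J))%N by rewrite ltn_ceil// muln_gt0.
clearbody m; split=> //; first by rewrite -mulnA; lia.
by apply: (leq_trans (ltnW Km)); nia.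
Qed.

Section rate.
Context (R : realType) (delta : R) (hdelta : 0 < delta < 1).
Let D := ln (32 / delta).

(** In units of ln (2 n)^3 n^(-2/5): the blocks contribute 2 * 1280 J / m^2, where
    J / m^2 <= 1024 * 8 since n^(1/5) <= 32 m J and J <= 2 ln (2 n); the neglected
    tails contribute 2 / 2^J <= 2, and 6 sqrt tau the rest. *)
Definition rate_constant : R := 1280 * 1024 * 16 + 2 + 6 * (16 + 4 * D).

Variable n : nat.
Hypothesis n0 : (0 < n)%N.
Let nu : R := n%:R `^ (1 / 5).
Let K := ceil_root5 R n.
Let L : R := ln (2 * n%:R).

Lemma fifth_root_ge1 : 1 <= nu.
Proof.
have n1 : 1 <= n%:R :> R by rewrite ler1n.
by have := @ler_powR R n%:R n1 0 (1 / 5); rewrite powRr0; apply; lra.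
Qed.

Lemma fifth_rootX : nu ^+ 5 = n%:R.
Proof.
by rewrite -powR_mulrn ?powR_ge0// -powRrM mul1r mulVf// powRr1.
Qed.

Lemma fifth_root_powN : n%:R `^ (- (2 / 5)) = (nu ^+ 2)^-1.
Proof.
rewrite powRN -powR_mulrn ?powR_ge0// -powRrM.
by congr (_ `^ _)^-1; field.
Qed.

Lemma ceil_root5_bounds : nu <= K%:R /\ K%:R <= 2 * nu.
Proof.
have nu1 := fifth_root_ge1.
have c0 : 0 <= Num.ceil nu by rewrite ceil_ge0; lra.
have -> : K%:R = (Num.ceil nu)%:~R :> R.
  by rewrite /K /ceil_root5 natr_absz ger0_norm.
have /andP[h1 h2] := ceil_itv nu.
by split=> //; move: h1; rewrite intrB; lra.
Qed.

Lemma sqrt_tau_le : tau (@interval_unions R K) n delta <= 1 / 2 ->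
  Num.sqrt (tau (@interval_unions R K) n delta) <= (16 + 4 * D) * L ^+ 3 / nu ^+ 2.
Proof.
move=> tau12; have L1 : 1 <= L by exact: ln2n_ge1 tau12.
have D1 : 1 <= D by exact: ln_delta_ge1.
have nu1 := fifth_root_ge1; have [_ Knu] := ceil_root5_bounds.
have nu0 : 0 < nu by lra.
set A := 16 + 4 * D; have A1 : 1 <= A by rewrite /A; lra.
set X := _ / _; have X0 : 0 <= X.
  by rewrite /X divr_ge0 ?exprn_ge0 ?mulr_ge0 ?exprn_ge0//; lra.
rewrite -[leRHS]ger0_norm// -sqrtr_sqr ler_wsqrtr// tauE -/L -/D -fifth_rootX.
apply: (@le_trans _ _ (A * L / nu ^+ 4)).
  rewrite ler_pdivrMr ?exprn_gt0//.
  have -> : A * L / nu ^+ 4 * nu ^+ 5 = A * (L * nu) by field; rewrite gt_eqF.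
  have KL : K%:R * L <= 2 * (L * nu).
    by rewrite [L * nu]mulrC mulrA ler_wpM2r//; lra.
  have Lnu : 1 <= L * nu by rewrite -[1]mulr1 ler_pM.
  have H : D <= D * (L * nu) by rewrite ler_peMr//; lra.
  by rewrite natrM /A; lra.
have -> : X ^+ 2 = A ^+ 2 * L ^+ 6 / nu ^+ 4 by rewrite /X; field; rewrite gt_eqF.
rewrite ler_wpM2r ?invr_ge0 ?exprn_ge0//; first by lra.
have -> : A ^+ 2 * L ^+ 6 = (A * L) * (A * L ^+ 5) by ring.
by rewrite ler_peMr ?mulr_ge0//; [lra|lra|rewrite -[1]mulr1 ler_pM// exprn_ege1].
Qed.

Lemma number_of_scales : exists J : nat,
  [/\ (0 < J)%N, J%:R <= 2 * L & 1 / 2 ^+ J <= (n%:R)^-1 :> R].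
Proof.
exists (trunc_log 2 n).+1; have n0' : 0 < n%:R :> R by rewrite ltr0n.
split=> //; last first.
  rewrite mul1r lef_pV2 ?posrE ?exprn_gt0// -natrX ler_nat ltnW//.
  exact: trunc_log_ltn.
set J := (trunc_log 2 n).+1.
have ln2 : 1 / 2 <= ln 2 :> R.
  rewrite -[1 / 2]expRK ler_ln ?posrE ?expR_gt0//.
  have : expR (1 / 2) ^+ 2 <= 2 ^+ 2 :> R.
    rewrite -expRM_natl mul1r mulfV//; have -> : 2 ^+ 2 = 4 :> R by ring.
    exact: expR1_le4.
  by rewrite ler_pXn2r ?nnegrE ?expR_ge0.
have : J%:R * ln 2 <= L.
  rewrite mulr_natl -lnXn// /L ler_ln ?posrE ?exprn_gt0 ?mulr_gt0//.
  by rewrite exprS ler_pM2l// -natrX ler_nat trunc_logP.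
have : 0 <= J%:R :> R by [].
nra.
Qed.

(** If K < 32 J, then n^(1/5) <= 64 ln (2 n) and the required separation exceeds 1.
    Otherwise about K / (16 J) pieces per scale are affordable. *)
Lemma breakpoint_budget : tau (@interval_unions R K) n delta <= 1 / 2 ->
  rate_constant * n%:R `^ (- (2 / 5)) * L `^ 3 <= 1 ->
  exists m J : nat, [/\ (1 < m)%N, (2 * (2 + 4 * m * J) < K)%N &
    2 * (1280 * J%:R / m%:R ^+ 2 + 1 / 2 ^+ J) +
      6 * Num.sqrt (tau (@interval_unions R K) n delta)
    <= rate_constant * n%:R `^ (- (2 / 5)) * L `^ 3].
Proof.
move=> tau12; have L1 : 1 <= L by exact: ln2n_ge1 tau12.
have D1 : 1 <= D by exact: ln_delta_ge1.
have nu1 := fifth_root_ge1; have [nuK _] := ceil_root5_bounds.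
have nu0 : 0 < nu by lra.
have nu2 : 0 < nu ^+ 2 by rewrite exprn_gt0.
have L3 : L ^+ 2 <= L ^+ 3 by rewrite exprS ler_peMl// ?sqr_ge0.
have -> : L `^ 3 = L ^+ 3 by rewrite powR_mulrn//; lra.
rewrite fifth_root_powN -mulrA [_^-1 * _]mulrC; set B := L ^+ 3 / nu ^+ 2.
have [J [J0 JL Jn]] := number_of_scales.
have J0' : 0 < J%:R :> R by rewrite ltr0n.
have [JK|KJ] := leqP (32 * J) K; last first.
  move=> CB; exfalso.
  have nuL : nu <= 64 * L.
    have : K%:R <= (32 * J)%:R :> R by rewrite ler_nat ltnW.
    by rewrite natrM; lra.
  have : nu ^+ 2 <= 4096 * L ^+ 2.
    have -> : 4096 * L ^+ 2 = (64 * L) ^+ 2 by ring.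
    by rewrite lerXn2r ?nnegrE//; lra.
  move=> H; have : 1 <= 4096 * B.
    by rewrite /B mulrA ler_pdivlMr// mul1r; lra.
  move: CB; rewrite /rate_constant; set b := B => CB b1.
  have : 0 <= D * b.
    apply: mulr_ge0; first exact: le_trans ler01 D1.
    by apply: divr_ge0; apply: exprn_ge0; [exact: le_trans ler01 L1|exact: ltW].
  lra.
move=> _; have [m [m2 mJK Km]] := pieces_per_scale J0 JK.
exists m, J; split=> //.
have m0 : 0 < m%:R :> R by rewrite ltr0n ltnW.
have KmJ : nu <= 32 * (m%:R * J%:R).
  apply: (le_trans nuK); have -> : 32 * (m%:R * J%:R) = (32 * (m * J))%:R :> R.
    by rewrite !natrM.
  by rewrite ler_nat.
have h1 : J%:R / m%:R ^+ 2 <= 1024 * 8 * B.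
  rewrite /B mulrA ler_pdivlMr// mulrAC ler_pdivrMr ?exprn_gt0//.
  have : nu ^+ 2 <= (32 * (m%:R * J%:R)) ^+ 2.
    by rewrite lerXn2r ?nnegrE ?mulr_ge0// ltW.
  move=> /(ler_wpM2l (ltW J0')) /le_trans; apply.
  have -> : J%:R * (32 * (m%:R * J%:R)) ^+ 2 = 1024 * J%:R ^+ 3 * m%:R ^+ 2 :> R by ring.
  have JL3 : J%:R ^+ 3 <= 8 * L ^+ 3.
    have -> : 8 * L ^+ 3 = (2 * L) ^+ 3 by ring.
    by apply: lerXn2r; rewrite ?nnegrE//; lra.
  apply: ler_wpM2r; first by apply: exprn_ge0; exact: ltW.
  lra.
have h2 : 1 / 2 ^+ J <= B.
  apply: (le_trans Jn); rewrite -fifth_rootX; apply: (@le_trans _ _ (1 / nu ^+ 2)).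
    by rewrite mul1r lef_pV2 ?posrE ?exprn_gt0// ler_weXn2l.
  by apply: ler_wpM2r; [rewrite invr_ge0 ltW|exact: exprn_ege1].
have h3 := sqrt_tau_le tau12; rewrite -mulrA -/B in h3.
rewrite -[1280 * _ / _]mulrA; move: h1 h2 h3; rewrite /rate_constant.
move: (J%:R / m%:R ^+ 2) (1 / 2 ^+ J) (Num.sqrt _) B => y z T b h1 h2 h3.
lra.
Qed.

End rate.

Section near_optimal_union.
Context (R : realType).
Local Notation RR := (measurableTypeR R).

Lemma tv_dist_gt (P Q : probability RR R) (eps : R) :
  (eps%:E < tv_dist P Q)%E ->
  exists2 A : set RR, measurable A & eps < pr Q A - pr P A.
Proof.
move=> /ereal_sup_gt[_ [A mA <-]]; rewrite !prE// -EFinB lte_fin => epsA.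
have [QP|PQ] := leP (pr P A) (pr Q A).
  by exists A => //; move: epsA; rewrite distrC ger0_norm ?subr_ge0.
exists (~` A); first exact: measurableC.
by move: epsA; rewrite ger0_norm ?subr_ge0 ?ltW// !pr_setC//; lra.
Qed.

Lemma log_concave_interval_union (P Q : probability RR R) (K m J : nat) (eps : R) :
  log_concave_distribution P -> log_concave_distribution Q ->
  (1 < m)%N -> (2 * (2 + 4 * m * J) < K)%N -> (eps%:E < tv_dist P Q)%E ->
  exists2 S, interval_unions K S &
    eps < pr Q S - pr P S + 2 * (1280 * J%:R / m%:R ^+ 2 + 1 / 2 ^+ J).
Proof.
move=> [p [mp p0 lcp Pp]] [q [mq q0 lcq Qq]] m1 mJK /tv_dist_gt[A mA epsA].
have [s [g [ss pwg mg _ ge]]] := log_concave_approx mp p0 lcp Pp J m1.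
have [t [h [ts pwh mh _ he]]] := log_concave_approx mq q0 lcq Qq J m1.
have stK : (size s + size t < K)%N by lia.
have [S SK SE] := sign_set_interval_union stK pwg pwh.
exists S => //; apply: (lt_le_trans epsA).
set e := 1280 * _ / _ + _ in ge he *.
have mS := measurable_interval_unions SK.
have mN : measurable ([set` s ++ t] : set RR) by exact: measurable_seq.
have := @sign_set_near_optimal R P Q p q mp p0 Pp mq q0 Qq g h A S [set` s ++ t] e e
  mg mh ge he mA mS mN (pr_seq mq q0 Qq _).
have -> : 2 * e = e + e by ring.
apply=> x; split=> [/SE[/negP ? ?]|[/negP ? ?]]; first by split.
by apply/SE; split.
Qed.

End near_optimal_union.

Theorem corollary6p1 (R : realType) (delta : R) (hdelta : 0 < delta < 1) :
  exists C c : R, [/\ 0 < C, 0 < c &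
    forall (n : nat) (eps1 eps2 : R),
      let Ss : set (set R) := interval_unions (ceil_root5 R n) in
      let test := psi Ss (g_tv eps1) n delta in
      (0 < n)%N -> tau Ss n delta <= 1 / 2 ->
      0 <= eps1 -> eps1 <= eps2 -> eps2 <= 1 ->
      C * n%:R `^ (- (2 / 5)) * ln (2 * n%:R) `^ c <= eps2 - eps1 ->
      (ereal_sup
         [set 'E_(iid_law PQ.1 n \x iid_law PQ.2 n)[test]
         | PQ in [set PQ : probability (measurableTypeR R) R *
                           probability (measurableTypeR R) R |
                  tv_dist PQ.1 PQ.2 <= eps1%:E]] <= delta%:E)%E /\
      (ereal_sup
         [set 'E_(iid_law PQ.1 n \x iid_law PQ.2 n)[fun z => (1 - test z)%R]
         | PQ in [set PQ : probability (measurableTypeR R) R *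
                           probability (measurableTypeR R) R |
                  [/\ log_concave_distribution PQ.1,
                      log_concave_distribution PQ.2 &
                      eps2%:E < tv_dist PQ.1 PQ.2]]] <= delta%:E)%E].
Proof.
exists (rate_constant delta), 3; split=> //.
  by rewrite /rate_constant; have := ln_delta_ge1 hdelta; lra.
move=> n eps1 eps2 Ss test n0 tau12 eps1_ge0 eps12 eps2_le1 gap.
split; apply: ge_ereal_sup => _ [[P Q] /= PQ <-].
  exact: type_one_error.
have [lcP lcQ tvPQ] := PQ.
have gap1 : rate_constant delta * n%:R `^ (- (2 / 5)) * ln (2 * n%:R) `^ 3 <= 1.
  by apply: (le_trans gap); lra.
have [m [J [m1 mJK budget]]] := breakpoint_budget hdelta n0 tau12 gap1.
have [S SK epsS] := log_concave_interval_union lcP lcQ m1 mJK tvPQ.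
apply: (type_two_error (S := S)) => //.
have mS : measurable (S : set (measurableTypeR R)) by exact: measurable_interval_unions SK.
rewrite pr_setC// -/Ss.
have {}gap := le_trans budget gap; move: gap epsS; rewrite -/Ss.
move: (1280 * _ / _ + _) (Num.sqrt _) => e s gap epsS; lra.
Qed.
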